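(* Let $K\ge 3$, let $\{\mathcal S_m\}_{m\in[M]}$ be security input sets and $\{\mathcal T_n\}_{n\in[N]}$ colluding user sets (monotone set systems of subsets of $[K]$ with $\bigcup_m\mathcal S_m\neq\emptyset$ and $|\mathcal T_n|\le K-2$ for all $n$). Then the optimal rate region of decentralized secure aggregation is $$\mathcal R^*=\{(R_X,R_{Z_\Sigma}) : R_X\ge 1,\ R_{Z_\Sigma}\ge R^*_{Z_\Sigma}\},$$ where $$R^*_{Z_\Sigma}=\begin{cases}K-1, & \text{if } a^*=K,\\ a^*, & \text{else if } a^*<|\overline{\mathcal S}|,\ \text{or } a^*=|\overline{\mathcal S}| \text{ and } |\mathcal Q|<K,\\ a^*+b^*, & \text{otherwise,}\end{cases}$$ and $b^*$ is the optimal value of the following linear program in the variables $b_k$, $k\in[K]\setminus\overline{\mathcal S}$: $$\min\ \max_{m,n,u:\,|\mathcal A_{m,n,u}|=a^*}\ \sum_{k\in(\mathcal T_n\cup\{u\})\setminus\overline{\mathcal S}} b_k$$ subject to $$\sum_{k\in[K]\setminus(\mathcal S_m\cup\mathcal T_n\cup\{u\})} b_k\ge 1\quad\text{for all } m,n,u \text{ with } |\mathcal A_{m,n,u}|=a^*,\qquad b_k\ge 0\quad\text{for all } k\in[K]\setminus\overline{\mathcal S}.$$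
   Context: Notation: $[K]=\{1,\dots,K\}$. All entropies and mutual informations are in $q$-ary units. Set systems. $\{\mathcal S_1,\dots,\mathcal S_M\}$ and $\{\mathcal T_1,\dots,\mathcal T_N\}$ are collections of subsets of $[K]$, each monotone (closed under taking subsets), with $\bigcup_m\mathcal S_m\ne\emptyset$ and $|\mathcal T_n|\le K-2$ for all $n$. Indices range over $m\in[M]$, $n\in[N]$, $u\in[K]$. Scheme. A decentralized secure aggregation scheme consists of a finite field $\mathbb F_q$, an input length $L$, a source key $Z_\Sigma$ consisting of $L_{Z_\Sigma}$ symbols of $\mathbb F_q$, keys $Z_1,\dots,Z_K$ and messages $X_1,\dots,X_K$, each $X_k$ consisting of $L_X$ symbols of $\mathbb F_q$. The inputs $W_1,\dots,W_K$ are mutually independent, each uniform on $\mathbb F_q^{L}$ (so $H(W_k)=L$), and $(W_k)_{k\in[K]}$ is independent of $(Z_k)_{k\in[K]}$, i.e. $H(W_{1:K},Z_{1:K})=\sum_k H(W_k)+H(Z_{1:K})$. The keys may be arbitrarily correlated and are functions of the source key: $H(Z_{1:K}\mid Z_\Sigma)=0$. Each message is a function of its user's input and key: $H(X_k\mid W_k,Z_k)=0$. Correctness: for every $u\in[K]$, $H\big(\sum_{k\in[K]}W_k \,\big|\, \{X_k\}_{k\in[K]\setminus\{u\}},W_u,Z_u\big)=0$. Security: for all $m\in[M]$, $n\in[N]$, $u\in[K]$, $$I\Big(\{W_k\}_{k\in\mathcal S_m};\{X_k\}_{k\in[K]\setminus\{u\}}\,\Big|\,\sum_{k\in[K]}W_k,\,W_u,\,Z_u,\,\{W_k,Z_k\}_{k\in\mathcal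 T_n}\Big)=0.$$ Rates. The communication rate of the scheme is $L_X/L$ and the source key rate is $L_{Z_\Sigma}/L$. A pair $(R_X,R_{Z_\Sigma})$ is achievable if there is a scheme satisfying correctness and security with communication rate at most $R_X$ and source key rate at most $R_{Z_\Sigma}$. The optimal rate region $\mathcal R^*$ is the closure of the set of achievable pairs. Combinatorial quantities. - Implicit security input set $\mathcal S_I\subseteq[K]$: the set of all users $v\in[K]\setminus\bigcup_{i\in[M]}\mathcal S_i$ such that $[K]\setminus(\mathcal S_m\cup\mathcal T_n\cup\{u\})=\{v\}$ for some $m,n,u$ (so $|\mathcal S_m\cup\mathcal T_n\cup\{u\}|=K-1$). - Total security input set $\overline{\mathcal S}=\bigcup_{m\in[M]}\mathcal S_m\cup\mathcal S_I$. - $\mathcal A_{m,n,u}=(\mathcal S_m\cup\mathcal T_n\cup\{u\})\cap\overline{\mathcal S}$ and $a^*=\max_{m\in[M],n\in[N],u\in[K]}|\mathcal A_{m,n,u}|$. - $\mathcal Q=\bigcup_{m,n,u:\,|\mathcal A_{m,n,u}|=a^*}(\mathcal S_m\cup\mathcal T_n\cup\{u\})$. *)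

(* Defs.v *)
From HB Require Import structures.
From mathcomp Require Import all_boot all_order all_algebra.
From mathcomp Require Import all_classical all_reals all_analysis.

Set Implicit Arguments.
Unset Strict Implicit.
Unset Printing Implicit Defensive.

Import Order.TTheory GRing.Theory Num.Theory.
Import numFieldNormedType.Exports.

Local Open Scope ring_scope.

(* Probability is discrete, on a finite sample space [Om] with mass function
   [mu]; the users 1, ..., K are the elements of 'I_K. *)

Definition rv_mass (R : realType) (Om : finType) (mu : Om -> R)
    (A : finType) (X : Om -> A) (a : A) : R :=
  \sum_(w | X w == a) mu w.

Definition joint (Om : finType) (A B : finType) (X : Om -> A) (Y : Om -> B) :
    Om -> A * B :=
  fun w => (X w, Y w).

Definition logb (R : realType) (q : nat) (x : R) : R := ln x / ln q%:R.

(* The convention 0 log 0 = 0 holds because of the factor [rv_mass]; the same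
   remark applies to [cond_entropy], where p(y) = 0 forces p(x, y) = 0. *)
Definition entropy (R : realType) (Om : finType) (mu : Om -> R) (q : nat)
    (A : finType) (X : Om -> A) : R :=
  - \sum_(a : A) rv_mass mu X a * logb q (rv_mass mu X a).

Definition cond_entropy (R : realType) (Om : finType) (mu : Om -> R) (q : nat)
    (A B : finType) (X : Om -> A) (Y : Om -> B) : R :=
  - \sum_(a : A) \sum_(b : B)
      rv_mass mu (joint X Y) (a, b)
        * logb q (rv_mass mu (joint X Y) (a, b) / rv_mass mu Y b).

(* I(X; Y | Z) = H(X | Z) - H(X | Y, Z) *)
Definition cond_mutual_info (R : realType) (Om : finType) (mu : Om -> R)
    (q : nat) (A B C : finType) (X : Om -> A) (Y : Om -> B) (Z : Om -> C) : R :=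
  cond_entropy mu q X Z - cond_entropy mu q X (joint Y Z).

(* The random variable (X_k)_{k in A}. *)
Definition family_on (K : nat) (Om V : finType) (A : {set 'I_K})
    (X : 'I_K -> Om -> V) : Om -> {ffun {k : 'I_K | k \in A} -> V} :=
  fun w => [ffun k => X (val k) w].

(* All keys share one finite alphabet [key_alphabet]; this is no restriction,
   since different alphabets embed into their disjoint union.  Neither the law
   of the source key nor the shape of the individual keys is prescribed. *)
Record scheme (R : realType) (K : nat) := Scheme {
  Fq : finFieldType;
  input_len : nat;
  message_len : nat;
  source_key_len : nat;
  key_alphabet : finType;
  Om : finType;
  mu : Om -> R;
  input : 'I_K -> Om -> 'rV[Fq]_input_len;
  source_key : Om -> 'rV[Fq]_source_key_len;
  key : 'I_K -> Om -> key_alphabet;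
  message : 'I_K -> Om -> 'rV[Fq]_message_len;
  input_len_gt0 : (0 < input_len)%N;
  mu_ge0 : forall w, 0 <= mu w;
  mu_sum1 : \sum_w mu w = 1;
  input_uniform : forall k x,
    rv_mass mu (input k) x = (#|Fq|%:R ^+ input_len)^-1;
  input_indep : forall x : 'I_K -> 'rV[Fq]_input_len,
    \sum_(w | [forall k, input k w == x k]) mu w
      = \prod_(k < K) rv_mass mu (input k) (x k);
  input_key_indep :
    entropy mu #|Fq| (joint (family_on [set: 'I_K] input)
                            (family_on [set: 'I_K] key))
      = \sum_(k < K) entropy mu #|Fq| (input k)
        + entropy mu #|Fq| (family_on [set: 'I_K] key);
  key_of_source :
    cond_entropy mu #|Fq| (family_on [set: 'I_K] key) source_key = 0;
  message_local : forall k,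
    cond_entropy mu #|Fq| (message k) (joint (input k) (key k)) = 0
}.

Definition input_sum (R : realType) (K : nat) (s : scheme R K) :
    Om s -> 'rV[Fq s]_(input_len s) :=
  fun w => \sum_(k < K) input k w.

Definition messages_except (R : realType) (K : nat) (s : scheme R K)
    (u : 'I_K) :=
  family_on (~: [set u]) (@message R K s).

Definition correct (R : realType) (K : nat) (s : scheme R K) : Prop :=
  forall u : 'I_K,
    cond_entropy (@mu R K s) #|Fq s| (@input_sum R K s)
      (joint (@messages_except R K s u) (joint (@input R K s u) (@key R K s u)))
    = 0.

Definition secure (R : realType) (K M N : nat) (S : 'I_M -> {set 'I_K})
    (T : 'I_N -> {set 'I_K}) (s : scheme R K) : Prop :=
  forall (m : 'I_M) (n : 'I_N) (u : 'I_K),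
    cond_mutual_info (@mu R K s) #|Fq s|
      (family_on (S m) (@input R K s))
      (@messages_except R K s u)
      (joint (@input_sum R K s)
        (joint (joint (@input R K s u) (@key R K s u))
          (family_on (T n)
             (fun k => joint (@input R K s k) (@key R K s k)))))
    = 0.

Definition message_rate (R : realType) (K : nat) (s : scheme R K) : R :=
  (message_len s)%:R / (input_len s)%:R.

Definition source_key_rate (R : realType) (K : nat) (s : scheme R K) : R :=
  (source_key_len s)%:R / (input_len s)%:R.

Definition achievable (R : realType) (K M N : nat) (S : 'I_M -> {set 'I_K})
    (T : 'I_N -> {set 'I_K}) : set (R * R) :=
  [set r | exists s : scheme R K,
     [/\ correct s, secure S T s,
         message_rate s <= r.1 & source_key_rate s <= r.2]]%classic.

Definition optimal_region (R : realType) (K M N : nat)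
    (S : 'I_M -> {set 'I_K}) (T : 'I_N -> {set 'I_K}) : set (R * R) :=
  closure (@achievable R K M N S T).

Arguments optimal_region R [K M N] S T.

Definition monotone_system (K M : nat) (S : 'I_M -> {set 'I_K}) : Prop :=
  forall (m : 'I_M) (A : {set 'I_K}), A \subset S m -> exists m', S m' = A.

Definition covered (K M N : nat) (S : 'I_M -> {set 'I_K})
    (T : 'I_N -> {set 'I_K}) (m : 'I_M) (n : 'I_N) (u : 'I_K) : {set 'I_K} :=
  S m :|: T n :|: [set u].

Definition explicit_set (K M : nat) (S : 'I_M -> {set 'I_K}) : {set 'I_K} :=
  (\bigcup_(m < M) S m)%SET.

Definition implicit_set (K M N : nat) (S : 'I_M -> {set 'I_K})
    (T : 'I_N -> {set 'I_K}) : {set 'I_K} :=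
  [set v in ~: explicit_set S |
     [exists m, exists n, exists u, ~: covered S T m n u == [set v]]]%SET.

Definition total_set (K M N : nat) (S : 'I_M -> {set 'I_K})
    (T : 'I_N -> {set 'I_K}) : {set 'I_K} :=
  explicit_set S :|: implicit_set S T.

Definition covered_total (K M N : nat) (S : 'I_M -> {set 'I_K})
    (T : 'I_N -> {set 'I_K}) (m : 'I_M) (n : 'I_N) (u : 'I_K) : {set 'I_K} :=
  covered S T m n u :&: total_set S T.

Definition astar (K M N : nat) (S : 'I_M -> {set 'I_K})
    (T : 'I_N -> {set 'I_K}) : nat :=
  (\max_(m < M) \max_(n < N) \max_(u < K) #|covered_total S T m n u|)%N.

Definition extremal (K M N : nat) (S : 'I_M -> {set 'I_K})
    (T : 'I_N -> {set 'I_K}) (m : 'I_M) (n : 'I_N) (u : 'I_K) : bool :=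
  #|covered_total S T m n u| == astar S T.

Definition Qset (K M N : nat) (S : 'I_M -> {set 'I_K})
    (T : 'I_N -> {set 'I_K}) : {set 'I_K} :=
  (\bigcup_(m < M) \bigcup_(n < N) \bigcup_(u < K | extremal S T m n u)
     covered S T m n u)%SET.

(* The variables of the linear program are the b k with k \notin total_set S T.
   The program is only used when astar S T = #|total_set S T|; an extremal
   (m, n, u) then satisfies total_set S T \subset covered S T m n u, so that the
   values of b on total_set S T play no role. *)
Definition lp_feasible (R : realType) (K M N : nat) (S : 'I_M -> {set 'I_K})
    (T : 'I_N -> {set 'I_K}) (b : 'I_K -> R) : Prop :=
  (forall m n u, extremal S T m n u ->
     1 <= \sum_(k in ~: covered S T m n u) b k)
  /\ (forall k, k \notin total_set S T -> 0 <= b k).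

(* The sums are nonnegative at a feasible b, so the default value 0 of the
   maximum is harmless. *)
Definition lp_objective (R : realType) (K M N : nat) (S : 'I_M -> {set 'I_K})
    (T : 'I_N -> {set 'I_K}) (b : 'I_K -> R) : R :=
  \big[Num.max/0]_(m < M) \big[Num.max/0]_(n < N)
    \big[Num.max/0]_(u < K | extremal S T m n u)
      \sum_(k in (T n :|: [set u]) :\: total_set S T) b k.

Definition bstar (R : realType) (K M N : nat) (S : 'I_M -> {set 'I_K})
    (T : 'I_N -> {set 'I_K}) : R :=
  inf [set lp_objective S T b | b in @lp_feasible R K M N S T]%classic.

Definition Rstar (R : realType) (K M N : nat) (S : 'I_M -> {set 'I_K})
    (T : 'I_N -> {set 'I_K}) : R :=
  if astar S T == K then (K - 1)%N%:R
  else if (astar S T < #|total_set S T|)%N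
          || ((astar S T == #|total_set S T|) && (#|Qset S T| < K)%N)
       then (astar S T)%:R
  else (astar S T)%:R + bstar R S T.

(* Main.v *)
Require Import Defs.
From HB Require Import structures.
From mathcomp Require Import all_boot all_order all_algebra.
From mathcomp Require Import all_classical all_reals all_analysis.
From mathcomp Require Import ring lra.

Set Implicit Arguments.
Unset Strict Implicit.
Unset Printing Implicit Defensive.

Import Order.TTheory GRing.Theory Num.Theory.
Import numFieldNormedType.Exports.

Local Open Scope ring_scope.

(* Converse.  Entropies of families of inputs, keys, messages and the input sum
   form a polymatroid.  Let U = T_n + {u}, let S be disjoint from U and let V be
   the complement of S + U, assumed nonempty.  Security and correctness give
   H(Z_S | Z_U) >= |S| L and, if S is nonempty, H(Z_V | Z_U) >= L.  Peeling off
   the explicit users of U with the first bound and the implicit ones with the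
   second gives H(Z_1..Z_K) >= |A_{m,n,u}| L + H(Z_P), where P is the part of U
   outside the total security set.  In the last case of the formula a vertex of
   the base polytope of B |-> H(Z_B), B outside the total security set, divided
   by L, is feasible for the linear program.

   Achievability.  X_k = W_k + N_k and Z_k = N_k, where N is uniform on a linear
   space of families with sum 0.  Adding an element of that space to the keys
   and subtracting it from the inputs leaves the messages unchanged, so security
   only asks that the elements vanishing on U take every value on S that is
   compatible with the sum.  The space is the kernel of Vandermonde parity
   checks; weights b_k of the program become numbers of coordinates of user k. *)

(** * Discrete Shannon entropy: monotonicity, the cardinality bound and submodularity *)

Definition refines (Om A B : Type) (X : Om -> A) (Y : Om -> B) : Prop :=
  forall w w', Y w = Y w' -> X w = X w'.

Section Entropy.
Variables (R : realType) (Om : finType) (mu : Om -> R) (q : nat).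
Hypotheses (mu_ge0 : forall w, 0 <= mu w) (mu_sum1 : \sum_w mu w = 1).
Hypothesis (q_gt1 : (1 < q)%N).

Local Notation p X w := (rv_mass mu X (X w)).
Local Notation H X := (entropy mu q X).

Lemma lnq_gt0 : 0 < ln (q%:R : R).
Proof. by apply: ln_gt0; rewrite ltr1n. Qed.

Lemma lnqV_gt0 : 0 < (ln (q%:R : R))^-1.
Proof. by rewrite invr_gt0 lnq_gt0. Qed.

Lemma rv_mass_ge0 (A : finType) (X : Om -> A) a : 0 <= rv_mass mu X a.
Proof. exact: sumr_ge0. Qed.

Lemma sum_rv_mass (A : finType) (X : Om -> A) (g : A -> R) :
  \sum_a rv_mass mu X a * g a = \sum_w mu w * g (X w).
Proof.
rewrite [RHS](partition_big X xpredT) //=; apply: eq_bigr => a _.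
by rewrite /rv_mass mulr_suml; apply: eq_bigr => w /eqP ->.
Qed.

Lemma marginal (A B : finType) (X : Om -> A) (Y : Om -> B) b :
  \sum_a rv_mass mu (joint X Y) (a, b) = rv_mass mu Y b.
Proof.
rewrite /rv_mass [RHS](partition_big X xpredT) //=; apply: eq_bigr => a _.
by apply: eq_bigl => w; rewrite xpair_eqE andbC.
Qed.

Lemma le_rv_mass (A B : finType) (X : Om -> A) (Y : Om -> B) w :
  refines X Y -> p Y w <= p X w.
Proof.
move=> XY; rewrite /rv_mass big_mkcond [leRHS]big_mkcond; apply: ler_sum => v _.
have [/eqP /XY ->|_] := ifPn; first by rewrite eqxx.
by case: ifP.
Qed.

Lemma rv_mass_gt0 (A : finType) (X : Om -> A) w : 0 < mu w -> 0 < p X w.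
Proof.
move=> w0; rewrite /rv_mass (bigD1 w) //= ltr_wpDr //; exact: sumr_ge0.
Qed.

Lemma entropyE (A : finType) (X : Om -> A) :
  H X = - \sum_w mu w * logb q (p X w).
Proof. by rewrite /entropy (sum_rv_mass X (fun a => logb q (rv_mass mu X a))). Qed.

Lemma cond_entropyE (A B : finType) (X : Om -> A) (Y : Om -> B) :
  cond_entropy mu q X Y = H (joint X Y) - H Y.
Proof.
rewrite /cond_entropy pair_big /=.
rewrite (eq_bigr (fun ab : A * B => rv_mass mu (joint X Y) ab *
  logb q (rv_mass mu (joint X Y) ab / rv_mass mu Y ab.2))); last by case.
rewrite (sum_rv_mass (joint X Y) (fun ab => logb q (rv_mass mu (joint X Y) ab / rv_mass mu Y ab.2))).
rewrite !entropyE opprK -sumrN -sumrN -big_split /=; apply: eq_bigr => w _.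
have [->|w0] := eqVneq (mu w) 0; first by rewrite !mul0r oppr0 addr0.
have wp : 0 < mu w by rewrite lt_def w0 mu_ge0.
rewrite /logb ln_div ?posrE ?rv_mass_gt0 //; ring.
Qed.

Lemma le_entropy (A B : finType) (X : Om -> A) (Y : Om -> B) :
  refines X Y -> H X <= H Y.
Proof.
move=> XY; rewrite !entropyE lerN2; apply: ler_sum => w _.
have [->|w0] := eqVneq (mu w) 0; first by rewrite !mul0r.
have wp : 0 < mu w by rewrite lt_def w0 mu_ge0.
rewrite ler_wpM2l // /logb ler_wpM2r ?invr_ge0 ?(ltW lnq_gt0) //.
by rewrite ler_ln ?posrE ?rv_mass_gt0 // le_rv_mass.
Qed.

Lemma eq_entropy (A B : finType) (X : Om -> A) (Y : Om -> B) :
  refines X Y -> refines Y X -> H X = H Y.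
Proof. by move=> ? ?; apply/eqP; rewrite eq_le !le_entropy. Qed.

Lemma ln_le_subr1 (x : R) : 0 < x -> ln x <= x - 1.
Proof. by move=> x0; rewrite -[X in ln X](subrKC 1) le_ln1Dx //; lra. Qed.

(** Gibbs' inequality: [ln x <= x - 1] at x = 1 / (|A| p(X)). The mean of x is at most 1, because
    each value of positive mass contributes 1 / |A|. *)
Lemma entropy_le_card (A : finType) (X : Om -> A) : H X <= logb q #|A|%:R.
Proof.
have A0 : 0 < #|A|%:R :> R.
  rewrite ltr0n; apply/card_gt0P.
  case: (pickP (fun _ : Om => true)) => [w _|e]; first by exists (X w).
  by move: mu_sum1; rewrite big_pred0 // => /esym/eqP; rewrite oner_eq0.
have -> : logb q #|A|%:R = \sum_w mu w * logb q #|A|%:R.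
  by rewrite -mulr_suml mu_sum1 mul1r.
rewrite -subr_le0 entropyE -sumrN -sumrB.
suff: \sum_w mu w * ((#|A|%:R * p X w)^-1 - 1) <= 0.
  rewrite -(pmulr_lle0 _ lnqV_gt0) mulr_suml; apply: le_trans; apply: ler_sum => w _.
  have [->|w0] := eqVneq (mu w) 0; first by rewrite !(mul0r, oppr0, addr0).
  have wp : 0 < mu w by rewrite lt_def w0 mu_ge0.
  have pp := rv_mass_gt0 X wp.
  apply: (@le_trans _ _ (mu w * ln ((#|A|%:R * p X w)^-1) * (ln q%:R)^-1)); last first.
    by rewrite ler_pM2r ?lnqV_gt0 // ler_wpM2l // ln_le_subr1 // invr_gt0 mulr_gt0.
  rewrite lnV ?posrE ?mulr_gt0 // lnM ?posrE // /logb.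
  have := lnq_gt0; move: (ln q%:R) => l l0.
  rewrite le_eqVlt; apply/orP; left; apply/eqP; field; exact: lt0r_neq0.
under eq_bigr do rewrite mulrBr mulr1.
rewrite sumrB mu_sum1 subr_le0.
rewrite -(sum_rv_mass X (fun a => (#|A|%:R * rv_mass mu X a)^-1)).
apply: (@le_trans _ _ (\sum_(a : A) #|A|%:R^-1)).
  apply: ler_sum => a _; have [->|a0] := eqVneq (rv_mass mu X a) 0.
    by rewrite mul0r invr_ge0 ltW.
  by rewrite invfM mulrCA mulfV // mulr1.
by rewrite sumr_const -[_ *+ _]mulr_natr mulVf // lt0r_neq0.
Qed.

(** This is I(X; Y | Z) >= 0, again from [ln x <= x - 1], at the ratio p(x,z) p(y,z) / (p(x,y,z)
    p(z)), whose mean is at most 1. *)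
Lemma entropy_submod (A B C : finType) (X : Om -> A) (Y : Om -> B) (Z : Om -> C) :
  H (joint (joint X Y) Z) + H Z <= H (joint X Z) + H (joint Y Z).
Proof.
set XYZ := joint (joint X Y) Z; set XZ := joint X Z; set YZ := joint Y Z.
rewrite -subr_le0 !entropyE -!sumrN -!big_split /= -sumrN -big_split /=.
suff: \sum_w mu w * (p XZ w * p YZ w / (p XYZ w * p Z w) - 1) <= 0.
  rewrite -(pmulr_lle0 _ lnqV_gt0) mulr_suml; apply: le_trans; apply: ler_sum => w _.
  have [->|w0] := eqVneq (mu w) 0; first by rewrite !(mul0r, oppr0, addr0).
  have wp : 0 < mu w by rewrite lt_def w0 mu_ge0.
  have p1 := rv_mass_gt0 XYZ wp; have p2 := rv_mass_gt0 XZ wp.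
  have p3 := rv_mass_gt0 YZ wp; have p4 := rv_mass_gt0 Z wp.
  apply: (@le_trans _ _ (mu w * ln (p XZ w * p YZ w / (p XYZ w * p Z w)) * (ln q%:R)^-1)); last first.
    by rewrite ler_pM2r ?lnqV_gt0 // ler_wpM2l // ln_le_subr1 // divr_gt0 ?mulr_gt0.
  rewrite ln_div ?posrE ?mulr_gt0 // !lnM ?posrE // /logb.
  have := lnq_gt0; move: (ln q%:R) => l l0.
  rewrite le_eqVlt; apply/orP; left; apply/eqP; field; exact: lt0r_neq0.
under eq_bigr do rewrite mulrBr mulr1.
rewrite sumrB mu_sum1 subr_le0.
pose g (t : A * B * C) := rv_mass mu XZ (t.1.1, t.2) * rv_mass mu YZ (t.1.2, t.2) /
   (rv_mass mu XYZ t * rv_mass mu Z t.2).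
rewrite -(sum_rv_mass XYZ g).
(* Triples of mass 0 count on the larger side only; for fixed z that side factors into two
   marginals. *)
apply: (@le_trans _ _ (\sum_(t : A * B * C) rv_mass mu XZ (t.1.1, t.2) *
   (rv_mass mu YZ (t.1.2, t.2) / rv_mass mu Z t.2))).
  apply: ler_sum => t _; rewrite /g; have [->|a0] := eqVneq (rv_mass mu XYZ t) 0.
    by rewrite mul0r mulr_ge0 ?divr_ge0 ?rv_mass_ge0.
  rewrite invfM le_eqVlt; apply/orP; left; apply/eqP.
  have aux (t' a b c d : R) : t' * (a * b * (c * d)) = t' * c * (a * (b * d)) by ring.
  by rewrite aux mulfV // mul1r.
rewrite -(pair_bigA _ (fun (ab : A * B) c => rv_mass mu XZ (ab.1, c) *
   (rv_mass mu YZ (ab.2, c) / rv_mass mu Z c))) exchange_big /=.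
rewrite -mu_sum1 [leRHS](partition_big Z xpredT) //=; apply: ler_sum => c _.
rewrite -(pair_bigA _ (fun a b => rv_mass mu XZ (a, c) *
   (rv_mass mu YZ (b, c) / rv_mass mu Z c))) /=.
under eq_bigr do rewrite -mulr_sumr -mulr_suml marginal.
rewrite -mulr_suml marginal -/(rv_mass mu Z c).
have [->|c0] := eqVneq (rv_mass mu Z c) 0; first by rewrite mul0r.
by rewrite divff // mulr1.
Qed.

End Entropy.

(** * The converse for a polymatroid *)

Lemma set_ind (I : finType) (P : {set I} -> Prop) :
  P finset.set0 -> (forall k (D : {set I}), k \notin D -> P D -> P (k |: D)) -> forall D, P D.
Proof.
move=> P0 PS D; have [n] := ubnP #|D|; elim: n D => // n IH D.
have [-> //|/set0Pn[k kD]] := eqVneq D finset.set0.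
rewrite (cardsD1 k) kD ltnS => lt; rewrite -(finset.setD1K kD); apply: PS.
  by rewrite !inE eqxx.
exact: IH.
Qed.

(** Proves an inclusion pointwise, by cases on equalities with the tested point and then on
    memberships. The other goals it meets are implications between the flags for the sum. *)
Ltac setsolve :=
  match goal with |- is_true (_ \subset _) =>
    let x := fresh "x" in apply/fintype.subsetP => x; rewrite !inE;
    repeat match goal with
      H : (forall y, is_true (y \in _) -> _) |- _ => move: (H x); clear H end;
    repeat match goal with
      H : is_true (?y \in _) |- _ => move: H end;
    repeat match goal with
      H : is_true (?y \notin _) |- _ => move: H end;
    repeat match goal with
    | |- context [x == ?y] => case: (eqVneq x y) => [->|_] //=
    end;
    rewrite ?inE ?eqxx ?orbT //=;
    repeat match goal with
    | |- context [?y \in ?A] => case: (y \in A) => //=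
    end; done
  | _ => by rewrite ?orbF /= ?implybb ?implybT end.

Section Polymatroid.
Variables (R : realType) (K : nat) (L : R).
(* [h A B C f] is the joint entropy of the inputs in [A], the keys in [B], the
   messages in [C] and, when [f] holds, the sum of all inputs. *)
Variable h : {set 'I_K} -> {set 'I_K} -> {set 'I_K} -> bool -> R.
Local Notation o := (@finset.set0 'I_K).
Local Notation T := [set: 'I_K]%SET.

Hypothesis h_mono : forall (A B C : {set 'I_K}) f (A' B' C' : {set 'I_K}) f',
  A \subset A' -> B \subset B' -> C \subset C' -> f ==> f' ->
  h A B C f <= h A' B' C' f'.
(** Submodularity up to inclusions: each use names the four entropies it needs, and what remains are
    inclusions for [setsolve]. *)
Hypothesis h_sub : forall (A B C : {set 'I_K}) f (A1 B1 C1 : {set 'I_K}) f1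
  (A2 B2 C2 : {set 'I_K}) f2 (A3 B3 C3 : {set 'I_K}) f3,
  A \subset A1 :|: A2 -> B \subset B1 :|: B2 -> C \subset C1 :|: C2 -> f ==> f1 || f2 ->
  A3 \subset A1 :&: A2 -> B3 \subset B1 :&: B2 -> C3 \subset C1 :&: C2 -> f3 ==> f1 && f2 ->
  h A B C f + h A3 B3 C3 f3 <= h A1 B1 C1 f1 + h A2 B2 C2 f2.
Hypothesis h0 : h o o o false = 0.
Hypothesis h_indep : h T T o false = K%:R * L + h o T o false.
Hypothesis h_input : forall k, h [set k] o o false <= L.
Hypothesis h_local : forall k, h [set k] [set k] [set k] false <= h [set k] [set k] o false.
Hypothesis h_sum_le : h o o o true <= L.
Hypothesis h_sum_input : forall k, h T o o true <= h (~: [set k]) o o true.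
Hypothesis h_correct : forall u,
  h [set u] [set u] (~: [set u]) true <= h [set u] [set u] (~: [set u]) false.

(** The security condition I(W_S; (X_k)_{k != u} | sum, W_U, Z_U) <= 0, for a set [U] made of the
    decoder [u] and its colluders, written with joint entropies. *)
Definition hides (S U : {set 'I_K}) : Prop := exists2 u, u \in U &
  h (S :|: U) U o true - h U U o true
  <= h (S :|: U) U (~: [set u]) true - h U U (~: [set u]) true.

Local Notation c A := (#|A|%:R : R).

(** What a bundle determines, every larger bundle determines as well, by submodularity. Here
    [a b c f] determines [a' b' c' f'], and [A B C F] contains the former. *)
Lemma det_ext (a' b' c' : {set 'I_K}) f' (a b c : {set 'I_K}) f
  (A B C : {set 'I_K}) F (X Y Z : {set 'I_K}) G :
  h a' b' c' f' <= h a b c f ->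
  a \subset a' :&: A -> b \subset b' :&: B -> c \subset c' :&: C -> f ==> f' && F ->
  X \subset A :|: a' -> Y \subset B :|: b' -> Z \subset C :|: c' -> G ==> F || f' ->
  h X Y Z G <= h A B C F.
Proof.
move=> H ? ? ? ? ? ? ? ?.
have : h X Y Z G + h a b c f <= h A B C F + h a' b' c' f'.
  by apply: h_sub => //; rewrite 1?finset.setIC // andbC.
move: H; lra.
Qed.

Lemma input_le A A' b d f : h (A :|: A') b d f <= c A * L + h A' b d f.
Proof.
elim/set_ind: A => [|k D kD IH]; first by rewrite finset.set0U cards0 mul0r add0r.
have : h (k |: D :|: A') b d f + h o o o false
    <= h (D :|: A') b d f + h [set k] o o false.
  by apply: h_sub; setsolve.
rewrite cardsU1 kD natrD mulrDl mul1r h0; move: IH (h_input k); lra.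
Qed.

(** [h_indep] is the equality at the full sets. Subadditivity gives [<=] everywhere; a strict
    inequality at [A] and [B] would contradict [h_indep] once the other keys and inputs are
    added. *)
Lemma input_key A B : h A B o false = c A * L + h o B o false.
Proof.
have up := input_le A o B o false; rewrite finset.setU0 in up.
have up2 := input_le (~: A) A T o false.
rewrite finset.setUC finset.setUCr h_indep cardsCs finset.setCK card_ord in up2.
have : h A T o false + h o B o false <= h A B o false + h o T o false.
  by apply: h_sub; try setsolve.
have AK : (#|A| <= K)%N by rewrite -[leqRHS]card_ord max_card.
move: up up2; rewrite natrB // mulrBl; lra.
Qed.

Lemma message_det (a b d D : {set 'I_K}) f : D \subset a :&: b -> h a b (d :|: D) f <= h a b d f.
Proof.
elim/set_ind: D => [|k D kD IH]; first by rewrite finset.setU0.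
rewrite finset.subUset finset.sub1set inE => /andP[/andP[ka kb] Dab].
apply: le_trans (IH Dab).
apply: (@det_ext [set k] [set k] [set k] false [set k] [set k] o false) => //;
  try setsolve.
Qed.

Lemma sum_input k (a b d : {set 'I_K}) : ~: [set k] \subset a -> h T b d true <= h a b d true.
Proof.
move=> ka; apply: (@det_ext T o o true (~: [set k]) o o true) => //; try setsolve.
  by rewrite finset.subsetI ka finset.subsetT.
Qed.

Lemma correct_det u (a b d : {set 'I_K}) f : u \in a -> u \in b -> ~: [set u] \subset d ->
  h a b d true <= h a b d f.
Proof.
move=> ua ub ud; apply: (@det_ext [set u] [set u] (~: [set u]) true [set u] [set u] (~: [set u]) false);
  rewrite ?h_correct ?implybT ?orbT //; try setsolve.
by rewrite finset.subsetI ud andbT.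
Qed.

(** With all other inputs and keys, X_k gives every message, hence the sum by correctness at some
    [u != k], hence the independent input W_k. *)
Lemma message_fresh k : (1 < K)%N ->
  L <= h (~: [set k]) (~: [set k]) [set k] false - h (~: [set k]) (~: [set k]) o false.
Proof.
move=> K1; have [u uk] : exists u, u != k.
  have /set0Pn[u] : ~: [set k] != o.
    by rewrite -card_gt0 cardsCs finset.setCK cards1 card_ord subn_gt0.
  by rewrite !inE => uk; exists u.
set N := ~: [set k].
have uN : u \in N by rewrite !inE.
have h1 : h N N (k |: N) false <= h N N [set k] false by apply: message_det; rewrite finset.setIid.
have h2 : h N N (k |: N) true <= h N N (k |: N) false.
  by apply: (@correct_det u) => //; rewrite finset.setUCr finset.subsetT.
have h3 : h T N (k |: N) true <= h N N (k |: N) true by exact: (@sum_input k).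
have h4 : h T N o false <= h T N (k |: N) true by apply: h_mono; setsolve.
have := input_key T N; have := input_key N N.
have -> : #|N| = K.-1 by rewrite cardsCs finset.setCK cards1 card_ord subn1.
rewrite cardsT card_ord; have -> : K%:R = K.-1%:R + 1 :> R by rewrite natr1 prednK // ltnW.
move: h1 h2 h3 h4; rewrite mulrDl mul1r; lra.
Qed.

(** Chain rule over [S]: given the inputs and keys of everybody but [k], the messages of the earlier
    users are known and [message_fresh] applies. *)
Lemma messages_fresh (S a : {set 'I_K}) : (1 < K)%N -> (forall x, x \in S -> x \notin a) ->
  c S * L <= h a a S false - h a a o false.
Proof.
move=> K1; elim/set_ind: S => [|k S kS IH] Sa; first by rewrite cards0 mul0r subrr.
have Sa' : forall x, x \in S -> x \notin a by move=> x xS; apply: Sa; rewrite !inE xS orbT.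
have ka : k \notin a by apply: Sa; rewrite !inE eqxx.
have {IH} := IH Sa'.
rewrite cardsU1 kS natrD mulrDl mul1r.
have := message_fresh k K1; set N := ~: [set k].
have h1 : h N N (k |: S) false + h a a S false <= h a a (k |: S) false + h N N S false.
  by apply: h_sub; try setsolve.
have h2 : h N N (o :|: S) false <= h N N o false.
  apply: message_det; rewrite finset.setIid; apply/fintype.subsetP => x xS.
  by rewrite !inE (contraNneq _ kS) // => <-.
have h3 : h N N [set k] false <= h N N (k |: S) false by apply: h_mono; try setsolve.
rewrite finset.set0U in h2; move: h1 h2 h3; lra.
Qed.

(** In conditional form, H(W_S | X_S, W_U, Z_U) >= |S| L. By security it suffices to condition on
    the sum, W_U and Z_U; the input of the outside user [v] masks W_S in the sum. *)
Lemma hidden_inputs (S U : {set 'I_K}) v : v \notin S :|: U -> (forall x, x \in S -> x \notin U) ->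
  hides S U -> c S * L <= h (S :|: U) U S false - h U U S false.
Proof.
rewrite inE negb_or => /andP[vS vU] SU [u uU sec].
have h1 : h (S :|: U) U (~: [set u]) true + h U U S false
      <= h (S :|: U) U S false + h U U (~: [set u]) true.
  by apply: h_sub => //; try setsolve.
set N := ~: [set v].
have h2 : h N U o true + h U U o true <= h (S :|: U) U o true + h (N :\: S) U o true.
  by apply: h_sub; try setsolve.
have h3 : h T U o true <= h N U o true by exact: (@sum_input v).
have h4 : h T U o false <= h T U o true by apply: h_mono.
have h5 : h (N :\: S) U o true + h o o o false <= h (N :\: S) U o false + h o o o true.
  by apply: h_sub; try setsolve.
have := input_key T U; have := input_key (N :\: S) U.
have -> : #|T| = (1 + #|S| + #|N :\: S|)%N.
  rewrite cardsT -(cardsC (v |: S)) cardsU1 vS; congr (_ + #|(_ : {set 'I_K})|)%N.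
  by apply/finset.setP => x; rewrite !inE negb_or andbC.
rewrite !natrD !mulrDl mul1r; move: h1 h2 h3 h4 h5 sec h_sum_le; rewrite h0; lra.
Qed.

(** Given W_S, W_U and Z_U, the keys Z_S determine X_S. These messages have entropy at least |S| L
    before W_S is given, and keep that much afterwards because by [hidden_inputs] they say nothing
    about W_S. *)
Lemma hidden_keys (S U : {set 'I_K}) v : (1 < K)%N -> v \notin S :|: U -> (forall x, x \in S -> x \notin U) ->
  hides S U -> c S * L <= h o (S :|: U) o false - h o U o false.
Proof.
move=> K1 vN SU sec; have := hidden_inputs vN SU sec.
have := messages_fresh K1 SU.
have := input_key (S :|: U) (S :|: U); have := input_key (S :|: U) U.
have := input_key U U.
have h1 : h (S :|: U) (S :|: U) (o :|: S) false <= h (S :|: U) (S :|: U) o false.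
  by apply: message_det; setsolve.
have h2 : h (S :|: U) (S :|: U) S false + h (S :|: U) U o false
    <= h (S :|: U) (S :|: U) o false + h (S :|: U) U S false.
  by apply: h_sub; try setsolve.
have -> : c (S :|: U) = c S + c U.
  rewrite cardsU (_ : S :&: U = o) ?cards0 ?subn0 ?natrD //.
  by apply/finset.setP => x; rewrite !inE; case: (boolP (x \in S)) => // /SU /negbTE.
have h4 : h (S :|: U) U S false <= h (S :|: U) (S :|: U) S false by apply: h_mono; setsolve.
move: h1 h2 h4; rewrite finset.set0U mulrDl; lra.
Qed.

(* The messages of V reveal W_s once those of S and all other inputs are known
   (correctness), while without them W_s is still uniform (security). *)
Lemma outside_keys (S U : {set 'I_K}) s v : (1 < K)%N -> s \in S -> v \notin S :|: U ->
  (forall x, x \in S -> x \notin U) ->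
  hides S U -> L <= h o (~: S) o false - h o U o false.
Proof.
move=> K1 sS vN SU sec; have := hidden_inputs vN SU sec.
have [u uU _] := sec.
have sU : s \notin U by apply: SU.
set Q := ~: S; set N := ~: [set s]; set V := ~: (S :|: U).
have k1 := input_key Q Q; have k2 := input_key Q U.
have k3 := input_key T (S :|: U); have k4 := input_key (S :|: U) (S :|: U).
have h1 : h Q Q (o :|: Q) false <= h Q Q o false by apply: message_det; setsolve.
have h2 : h Q U V false <= h Q Q (o :|: Q) false by apply: h_mono; setsolve.
have h3 : h N U (~: U) false + h Q U o false <= h Q U V false + h N U S false.
  by apply: h_sub; try setsolve.
have h4 : h N U (~: U :|: U) false <= h N U (~: U) false.
  by apply: message_det; setsolve.
have h5 : h N U (~: U :|: U) true <= h N U (~: U :|: U) false.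
  by apply: (@correct_det u) => //; [|setsolve]; rewrite !inE; apply: contraNneq sU => <-.
have h6 : h T U (~: U :|: U) true <= h N U (~: U :|: U) true by exact: (@sum_input s).
have h7 : h T U S false <= h T U (~: U :|: U) true by apply: h_mono => //; setsolve.
(* It remains to see H(W_s | X_S, Z_U, all other inputs) >= L: [h8] and [h9] bound the entropy
   without W_s from above, [h10] to [h12] with [hidden_inputs] bound the one with W_s from below. *)
have h8 := input_le (S :\ s) Q U S false.
rewrite (_ : _ :|: Q = N) in h8; last first.
  by apply/finset.setP => x; rewrite !inE; case: (eqVneq x s) => [->|_]; rewrite ?sS ?orbN.
have h9 := input_le V U U S false.
rewrite (_ : V :|: U = Q) in h9; last first.
  by apply/finset.setP => x; rewrite !inE; have := SU x; case: (x \in S) => [/(_ isT)/negbTE|_] /=;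
    [move=> -> | rewrite orNb].
have h10 : h T (S :|: U) S false + h (S :|: U) U S false
    <= h T U S false + h (S :|: U) (S :|: U) S false by apply: h_sub; try setsolve.
have h11 : h (S :|: U) (S :|: U) (o :|: S) false <= h (S :|: U) (S :|: U) o false.
  by apply: message_det; setsolve.
have h12 : h T (S :|: U) o false <= h T (S :|: U) S false by apply: h_mono; setsolve.
rewrite finset.set0U in h11.
have cS : c S = 1 + c (S :\ s) by rewrite (cardsD1 s) sS natrD.
have cT : c T = c (S :|: U) + c V by rewrite cardsT -(cardsC (S :|: U)) natrD.
move: k3 h2 h3 h4 h5 h6 h7 h8 h9 h10 h11 h12; rewrite cT cS !mulrDl mul1r; lra.
Qed.

End Polymatroid.

(** * The entropies of a scheme *)

Lemma family_onP (K : nat) (O V : finType) (A : {set 'I_K}) (X : 'I_K -> O -> V) w w' :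
  family_on A X w = family_on A X w' <-> (forall k, k \in A -> X k w = X k w').
Proof.
split=> [/ffunP e k kA|e]; first by have := e (Sub k kA); rewrite !ffunE.
by apply/ffunP => -[k kA]; rewrite !ffunE; exact: e.
Qed.

Lemma entropy_cst (R : realType) (O : finType) (mu : O -> R) q (A : finType) (X : O -> A) :
  \sum_w mu w = 1 -> (forall w w', X w = X w') -> entropy mu q X = 0.
Proof.
move=> mu1 cst; rewrite entropyE big1 ?oppr0 // => w _.
rewrite /rv_mass (eq_bigl xpredT) ?mu1; last by move=> w'; apply/eqP.
by rewrite /logb ln1 mul0r mulr0.
Qed.

Lemma logb_exp (R : realType) q n : (1 < q)%N -> logb q (q%:R ^+ n : R) = n%:R.
Proof.
move=> q1; rewrite /logb lnXn ?ltr0n ?(ltnW q1) // -[_ *+ n]mulr_natl mulfK //.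
by rewrite lt0r_neq0 // lnq_gt0.
Qed.

Lemma entropy_le_dim (R : realType) (O : finType) (mu : O -> R) (F : finFieldType) n
    (X : O -> 'rV[F]_n) :
  (forall w, 0 <= mu w) -> \sum_w mu w = 1 -> entropy mu #|F| X <= n%:R.
Proof.
move=> mu0 mu1; rewrite -(@logb_exp R #|F| n) ?card_finNzRing_gt1 //.
have -> : #|F|%:R ^+ n = #|{: 'rV[F]_n}|%:R :> R by rewrite card_mx mul1n natrX.
exact: (entropy_le_card mu0 mu1 (card_finNzRing_gt1 _)).
Qed.

Lemma entropy_uniform (R : realType) (O : finType) (mu : O -> R) (F : finFieldType) n
    (X : O -> 'rV[F]_n) :
  (forall x, rv_mass mu X x = (#|F|%:R ^+ n)^-1) -> entropy mu #|F| X = n%:R.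
Proof.
move=> unif; rewrite /entropy.
under eq_bigr do rewrite unif.
have q0 : 0 < #|F|%:R :> R by rewrite ltr0n ltnW // card_finNzRing_gt1.
rewrite sumr_const card_mx mul1n -[_ *+ _]mulr_natl natrX mulrA mulfV ?mul1r; last first.
  by rewrite lt0r_neq0 // exprn_gt0.
rewrite -[RHS](@logb_exp R #|F|) ?card_finNzRing_gt1 // /logb lnV ?posrE ?exprn_gt0 //.
by rewrite mulNr opprK.
Qed.

Section SchemeEntropy.
Variables (R : realType) (K : nat) (s : scheme R K).
Local Notation q := #|Fq s|.
Local Notation L := ((input_len s)%:R : R).
Local Notation H X := (entropy (@mu R K s) q X).

(** The constant 0 carries no entropy, so one expression covers the bundles with and without the
    sum. *)
Definition bundle (A B C : {set 'I_K}) (f : bool) :=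
  joint (joint (family_on A (@input R K s)) (family_on B (@key R K s)))
    (joint (family_on C (@message R K s)) (fun w => if f then input_sum w else 0)).

Definition bundle_entropy A B C f : R := H (bundle A B C f).

Local Notation h := bundle_entropy.

Lemma bundleP A B C f w w' : bundle A B C f w = bundle A B C f w' <->
  [/\ forall k, k \in A -> input k w = input k w', forall k, k \in B -> key k w = key k w',
    forall k, k \in C -> message k w = message k w' & f -> input_sum w = input_sum w'].
Proof.
split=> [e|[/family_onP e1 /family_onP e2 /family_onP e3 e4]]; last first.
  by rewrite /bundle /joint e1 e2 e3; case: f e4 => // ->.
have e1 := congr1 (fun x => x.1.1) e; have e2 := congr1 (fun x => x.1.2) e.
have e3 := congr1 (fun x => x.2.1) e; have e4 := congr1 (fun x => x.2.2) e.
by split; try exact/family_onP; case: f {e e1 e2 e3} e4.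
Qed.

Lemma q_gt1 : (1 < q)%N. Proof. exact: card_finNzRing_gt1. Qed.

Let le_entropyS := le_entropy (@mu_ge0 R K s) q_gt1.
Let eq_entropyS := eq_entropy (@mu_ge0 R K s) q_gt1.

Lemma bundle_mono (A B C : {set 'I_K}) f (A' B' C' : {set 'I_K}) f' :
  A \subset A' -> B \subset B' -> C \subset C' -> f ==> f' -> h A B C f <= h A' B' C' f'.
Proof.
move=> /fintype.subsetP a /fintype.subsetP b /fintype.subsetP c /implyP ff.
apply: le_entropyS => w w' /bundleP[e1 e2 e3 e4]; apply/bundleP; split=> *; auto.
Qed.

Lemma bundle_sub (A B C : {set 'I_K}) f (A1 B1 C1 : {set 'I_K}) f1
  (A2 B2 C2 : {set 'I_K}) f2 (A3 B3 C3 : {set 'I_K}) f3 :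
  A \subset A1 :|: A2 -> B \subset B1 :|: B2 -> C \subset C1 :|: C2 -> f ==> f1 || f2 ->
  A3 \subset A1 :&: A2 -> B3 \subset B1 :&: B2 -> C3 \subset C1 :&: C2 -> f3 ==> f1 && f2 ->
  h A B C f + h A3 B3 C3 f3 <= h A1 B1 C1 f1 + h A2 B2 C2 f2.
Proof.
move=> /fintype.subsetP a /fintype.subsetP b /fintype.subsetP c /implyP ff.
rewrite !finset.subsetI => /andP[a1 a2] /andP[b1 b2] /andP[c1 c2] /implyP ff3.
set X := bundle A1 B1 C1 f1; set Y := bundle A2 B2 C2 f2; set Z := bundle A3 B3 C3 f3.
have ref (D1 D2 D3 : {set 'I_K}) (g : bool) (D1' D2' D3' : {set 'I_K}) (g' : bool) :
   D1 \subset D1' -> D2 \subset D2' -> D3 \subset D3' -> (g -> g') ->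
   refines (bundle D1 D2 D3 g) (bundle D1' D2' D3' g').
  move=> /fintype.subsetP ? /fintype.subsetP ? /fintype.subsetP ? ? w w' /bundleP[e1 e2 e3 e4].
  by apply/bundleP; split=> *; auto.
have ZX : refines Z X by apply: ref => // /ff3/andP[].
have ZY : refines Z Y by apply: ref => // /ff3/andP[].
have h1 : H (joint X Z) <= H X by apply: le_entropyS => w w' e; rewrite /joint e (ZX _ _ e).
have h2 : H (joint Y Z) <= H Y by apply: le_entropyS => w w' e; rewrite /joint e (ZY _ _ e).
have h3 := entropy_submod (@mu_ge0 R K s) (@mu_sum1 R K s) q_gt1 X Y Z.
have h4 : h A B C f <= H (joint (joint X Y) Z).
  apply: le_entropyS => w w' e.
  have /bundleP[x1 x2 x3 x4] : X w = X w' := congr1 (fun x => x.1.1) e.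
  have /bundleP[y1 y2 y3 y4] : Y w = Y w' := congr1 (fun x => x.1.2) e.
  apply/bundleP; split.
  - by move=> k /a; rewrite inE => /orP[]; auto.
  - by move=> k /b; rewrite inE => /orP[]; auto.
  - by move=> k /c; rewrite inE => /orP[]; auto.
  - by move=> /ff /orP[]; auto.
rewrite /bundle_entropy -/X -/Y -/Z; move: h1 h2 h3 h4; rewrite /bundle_entropy; lra.
Qed.

Lemma bundle0 : h finset.set0 finset.set0 finset.set0 false = 0.
Proof.
apply: entropy_cst; first exact: mu_sum1.
by move=> w w'; apply/bundleP; split=> // k; rewrite inE.
Qed.

Lemma bundle_indep :
  h [set: 'I_K] [set: 'I_K] finset.set0 false = K%:R * L + h finset.set0 [set: 'I_K] finset.set0 false.
Proof.
have := input_key_indep s.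
under eq_bigr do rewrite (entropy_uniform (@input_uniform R K s _)).
rewrite sumr_const card_ord -[_ *+ _]mulr_natl => e.
rewrite /bundle_entropy -[X in _ + X](_ : H (family_on [set: 'I_K] (@key R K s)) = _); last first.
  apply: eq_entropyS => w w'; last first.
    by move/family_onP => e2; apply/bundleP; split => // k; rewrite inE //.
  by move/bundleP => [_ e2 _ _]; apply/family_onP.
rewrite -e; apply: eq_entropyS => w w'.
  by move=> [/family_onP e1 /family_onP e2]; apply/bundleP; split => // k; rewrite inE //.
by move/bundleP => [/family_onP e1 /family_onP e2 _ _]; rewrite /joint e1 e2.
Qed.

Lemma bundle_input k : h [set k] finset.set0 finset.set0 false <= L.
Proof.
apply: le_trans (entropy_le_dim (@input R K s k) (@mu_ge0 R K s) (@mu_sum1 R K s)).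
apply: le_entropyS => w w' e; apply/bundleP; split=> // j; rewrite inE //.
by move/eqP => ->.
Qed.

Lemma bundle_local k :
  h [set k] [set k] [set k] false <= h [set k] [set k] finset.set0 false.
Proof.
have := message_local s k; rewrite (cond_entropyE _ (@mu_ge0 R K s)) => /eqP.
rewrite subr_eq0 => /eqP e.
apply: (@le_trans _ _ (H (joint (input k) (key k)))); last first.
  apply: le_entropyS => w w' /bundleP[e1 e2 _ _].
  by rewrite /joint e1 ?e2 // inE.
rewrite -e; apply: le_entropyS => w w' [e3 e1 e2]; apply/bundleP.
by split=> // j; rewrite inE => /eqP ->.
Qed.

Lemma bundle_sum_le : h finset.set0 finset.set0 finset.set0 true <= L.
Proof.
apply: le_trans (entropy_le_dim (@input_sum R K s) (@mu_ge0 R K s) (@mu_sum1 R K s)).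
by apply: le_entropyS => w w' e; apply/bundleP; split=> // j; rewrite inE.
Qed.

Lemma bundle_sum_input k :
  h [set: 'I_K] finset.set0 finset.set0 true <= h (~: [set k]) finset.set0 finset.set0 true.
Proof.
apply: le_entropyS => w w' /bundleP[e1 _ _ e4]; apply/bundleP; split=> // j; rewrite ?inE // => _.
have [->|jk] := eqVneq j k; last by apply: e1; rewrite !inE.
have := e4 isT; rewrite /input_sum (bigD1 k) //= [RHS](bigD1 k) //=.
rewrite (eq_bigr (fun i => input i w')); first by move/addIr.
by move=> i ik; apply: e1; rewrite !inE.
Qed.

Lemma bundle_correct u : correct s ->
  h [set u] [set u] (~: [set u]) true <= h [set u] [set u] (~: [set u]) false.
Proof.
move=> /(_ u); rewrite (cond_entropyE _ (@mu_ge0 R K s)) => /eqP.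
rewrite subr_eq0 => /eqP e.
set Y := (X in H (joint _ X) = H X) in e.
apply: (@le_trans _ _ (H Y)); last first.
  apply: le_entropyS => w w' /bundleP[e1 e2 e3 _].
  by rewrite /Y /joint e1 ?e2 ?inE //; congr (_, _); apply/family_onP.
rewrite -e; apply: le_entropyS => w w' [e4 /family_onP e3 e1 e2]; apply/bundleP.
by split=> // j; rewrite inE => /eqP ->.
Qed.

(** The decoder joins the colluders: the conditioning variable of the security constraint and the
    bundle over [T n :|: [set u]] determine each other, so the four joint entropies are those of
    [hides]. *)
Lemma bundle_hides M N (S : 'I_M -> {set 'I_K}) (T : 'I_N -> {set 'I_K}) m n u :
  secure S T s -> hides h (S m) (T n :|: [set u]).
Proof.
move=> /(_ m n u); rewrite /cond_mutual_info !(cond_entropyE _ (@mu_ge0 R K s)) => e.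
exists u; first by rewrite !inE eqxx orbT.
set U := T n :|: [set u].
set X := messages_except u in e.
set Y := (Y in _ - H (joint X Y)) in e.
have YP w w' : Y w = Y w' <-> bundle U U finset.set0 true w = bundle U U finset.set0 true w'.
  split=> [[e0 e1 e2 /family_onP e3]|/bundleP[e1 e2 _ e4]].
    apply/bundleP; split=> // k; rewrite inE //.
      by rewrite inE => /orP[/e3[]|/eqP->].
    by rewrite inE => /orP[/e3[]|/eqP->].
  rewrite /Y /joint e4 // e1 ?e2 ?inE ?eqxx ?orbT //; congr (_, (_, _)).
  by apply/family_onP => k kT; rewrite e1 ?e2 // inE kT.
have E1 : h U U finset.set0 true = H Y.
  by apply: eq_entropyS => w w' /YP.
have E2 : h U U (~: [set u]) true = H (joint X Y).
  apply: eq_entropyS => w w'.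
    move=> e0; have /family_onP e1 := congr1 fst e0.
    have /YP/bundleP[e2 e3 e4 e5] := congr1 snd e0.
    by apply/bundleP; split.
  move=> /bundleP[e2 e3 e4 e5]; congr (_, _); first exact/family_onP.
  by apply/YP/bundleP; split => // k; rewrite inE.
have E3 : h (S m :|: U) U finset.set0 true = H (joint (family_on (S m) (@input R K s)) Y).
  apply: eq_entropyS => w w'.
    move=> e0; have /family_onP e1 := congr1 fst e0.
    have /YP/bundleP[e2 e3 e4 e5] := congr1 snd e0.
    by apply/bundleP; split=> // k; rewrite inE => /orP[]; auto.
  move=> /bundleP[e2 e3 e4 e5]; congr (_, _).
    by apply/family_onP => k kS; apply: e2; rewrite inE kS.
  by apply/YP/bundleP; split => // k kU; apply: e2; rewrite inE kU orbT.
have E4 : h (S m :|: U) U (~: [set u]) true = H (joint (family_on (S m) (@input R K s)) (joint X Y)).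
  apply: eq_entropyS => w w'.
    move=> e0; have /family_onP e1 := congr1 fst e0.
    have /family_onP e6 := congr1 (fun x => x.2.1) e0.
    have /YP/bundleP[e2 e3 e4 e5] := congr1 (fun x => x.2.2) e0.
    by apply/bundleP; split=> // k; rewrite inE => /orP[]; auto.
  move=> /bundleP[e2 e3 e4 e5]; congr (_, (_, _)).
  - by apply/family_onP => k kS; apply: e2; rewrite inE kS.
  - exact/family_onP.
  - by apply/YP/bundleP; split => // k; [move=> kU; apply: e2; rewrite inE kU orbT | rewrite inE].
by rewrite E1 E2 E3 E4; move: e; lra.
Qed.

Lemma bundle_message k : h finset.set0 finset.set0 [set k] false <= (message_len s)%:R.
Proof.
apply: le_trans (entropy_le_dim (@message R K s k) (@mu_ge0 R K s) (@mu_sum1 R K s)).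
by apply: le_entropyS => w w' e; apply/bundleP; split=> // j; rewrite inE // => /eqP ->.
Qed.

Lemma bundle_keys : h finset.set0 [set: 'I_K] finset.set0 false <= (source_key_len s)%:R.
Proof.
apply: le_trans (entropy_le_dim (@source_key R K s) (@mu_ge0 R K s) (@mu_sum1 R K s)).
have := key_of_source s; rewrite (cond_entropyE _ (@mu_ge0 R K s)) => /eqP.
rewrite subr_eq0 => /eqP <-.
apply: le_entropyS => w w' [/family_onP e _].
by apply/bundleP; split=> // j; rewrite ?inE // => _; apply: e; rewrite inE.
Qed.

(** A message is fresh to all other users, so its entropy is at least [L], while it is at most its
    length. *)
Lemma message_len_ge : (1 < K)%N -> correct s -> L <= (message_len s)%:R.
Proof.
move=> K1 cor; have k : 'I_K := Ordinal K1.
have := message_fresh bundle_mono bundle_sub bundle0 bundle_indep bundle_input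
  bundle_local bundle_sum_input (fun u => bundle_correct u cor) k K1.
set N := ~: [set k].
have : h N N [set k] false + h finset.set0 finset.set0 finset.set0 false
  <= h N N finset.set0 false + h finset.set0 finset.set0 [set k] false.
  by apply: bundle_sub; rewrite ?finset.setU0 ?finset.set0U ?finset.sub0set.
move: (bundle_message k); rewrite bundle0; lra.
Qed.

Section Secure.
Variables (M N : nat) (S : 'I_M -> {set 'I_K}) (T : 'I_N -> {set 'I_K}).
Hypotheses (K_gt1 : (1 < K)%N) (s_correct : correct s) (s_secure : secure S T s).

Local Notation keys B := (h finset.set0 B finset.set0 false).

Lemma keys_hidden m n u v : v \notin S m :|: (T n :|: [set u]) ->
  (forall x, x \in S m -> x \notin T n :|: [set u]) ->
  #|S m|%:R * L <= keys (S m :|: (T n :|: [set u])) - keys (T n :|: [set u]).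
Proof.
move=> vN disj; exact: (hidden_keys bundle_mono bundle_sub bundle0 bundle_indep bundle_input
  bundle_local bundle_sum_le bundle_sum_input (fun u => bundle_correct u s_correct) K_gt1 vN disj
  (bundle_hides m n u s_secure)).
Qed.

Lemma keys_outside m n u x v : x \in S m -> v \notin S m :|: (T n :|: [set u]) ->
  (forall x, x \in S m -> x \notin T n :|: [set u]) ->
  L <= keys (~: S m) - keys (T n :|: [set u]).
Proof.
move=> xS vN disj; exact: (outside_keys bundle_mono bundle_sub bundle0 bundle_indep bundle_input
  bundle_local bundle_sum_le bundle_sum_input (fun u => bundle_correct u s_correct) K_gt1 xS vN disj
  (bundle_hides m n u s_secure)).
Qed.

End Secure.

End SchemeEntropy.

(** * Set systems and the lower bound on the source key *)

Lemma exists_notin (I : finType) (A : {set I}) : (#|A| < #|I|)%N -> exists x, x \notin A.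
Proof.
rewrite -(cardsC A) -[X in (X < _)%N]addn0 ltn_add2l card_gt0 => /set0Pn[x].
by rewrite inE => xA; exists x.
Qed.

(** The greedy vertex of the base polytope: each new element receives its marginal increment of
    [f]. *)
Lemma polymatroid_base (R : realType) (I : finType) (f : {set I} -> R) (D : {set I}) :
  f finset.set0 = 0 -> (forall A B : {set I}, A \subset B -> f A <= f B) ->
  (forall A B : {set I}, f (A :|: B) + f (A :&: B) <= f A + f B) ->
  exists b : I -> R, [/\ forall k, 0 <= b k,
    forall P : {set I}, P \subset D -> \sum_(k in P) b k <= f P &
    \sum_(k in D) b k = f D].
Proof.
move=> f0 fm fs; elim/set_ind: D => [|k D kD [b [b0 bP bD]]].
  exists (fun=> 0); split=> // [P|]; last by rewrite big1.
  by rewrite finset.subset0 => /eqP ->; rewrite big1 // f0.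
exists (fun j => if j == k then f (k |: D) - f D else b j); split.
- by move=> j; case: eqP => // _; rewrite subr_ge0 fm // finset.subsetUr.
- move=> P PD; have PkD : P :\ k \subset D by rewrite finset.subDset.
  have E : \sum_(j in P :\ k) (if j == k then f (k |: D) - f D else b j) <= f (P :\ k).
    apply: le_trans (bP _ PkD); rewrite le_eqVlt; apply/orP; left; apply/eqP.
    by apply: eq_bigr => j; rewrite !inE => /andP[/negbTE ->].
  have [kP|kP] := boolP (k \in P); last first.
    rewrite (_ : P :\ k = P) // in E; apply/finset.setP => x; rewrite !inE.
    by case: eqVneq => //= ->; rewrite (negbTE kP).
  rewrite (big_setD1 k) //= eqxx.
  (* [D] and [P] have union [k |: D] and intersection [P :\ k], so the increment of [k] over [D] is
     at most that over [P :\ k]. *)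
  have := fs D P; rewrite (_ : D :|: P = k |: D); last first.
    apply/finset.setP => x; rewrite !inE; have := fintype.subsetP PD x; rewrite !inE.
    by case: eqVneq => [->|_]; [rewrite kP orbT | case: (x \in P) => //= [->|]; rewrite ?orbF].
  rewrite (_ : D :&: P = P :\ k); last first.
    apply/finset.setP => x; rewrite !inE; have := fintype.subsetP PD x; rewrite !inE.
    by case: eqVneq => [->|_]; [rewrite (negbTE kD) | case: (x \in P) => //= [->|]; rewrite ?andbF].
  by move: E; lra.
- rewrite big_setU1 //= eqxx (eq_bigr b) ?bD ?subrK // => j jD.
  by case: eqVneq => // jk; rewrite -jk jD in kD.
Qed.

Section SetSystems.
Variables (K M N : nat) (S : 'I_M -> {set 'I_K}) (T : 'I_N -> {set 'I_K}).
Hypotheses (hK : (3 <= K)%N) (hN : (0 < N)%N).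
Hypotheses (hS : monotone_system S) (hT : monotone_system T).
Hypothesis hS0 : (\bigcup_(m < M) S m)%SET != finset.set0.
Hypothesis hT2 : forall n, (#|T n| <= K - 2)%N.

Local Notation U n u := (T n :|: [set u]).
Local Notation Sbar := (total_set S T).

Lemma coveredE m n u : covered S T m n u = S m :|: U n u.
Proof. by rewrite /covered finset.setUA. Qed.

(** Lets the peeling arguments shrink [U n u]. If [B] loses [u], it lies in [T n], and any member of
    [B] can play the decoder; this is where [B] has to be nonempty. *)
Lemma colluding_sub (B : {set 'I_K}) n u : B \subset U n u -> B != finset.set0 ->
  exists n' u', U n' u' = B.
Proof.
move=> BU /set0Pn[t tB]; have [uB|uB] := boolP (u \in B).
  have [n' e] := hT (finset.subsetIl (T n) B); exists n', u; rewrite e.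
  apply/finset.setP => x; rewrite !inE; have := fintype.subsetP BU x; rewrite !inE.
  by have [->|_] := eqVneq x u; rewrite ?uB ?orbT // orbF; case: (x \in B) => [->|]; rewrite ?andbF.
have BT : B \subset T n.
  apply/fintype.subsetP => x xB; have := fintype.subsetP BU x xB; rewrite !inE => /orP[//|/eqP xu].
  by rewrite -xu xB in uB.
have [n' e] := hT BT; exists n', t; rewrite e; apply/finset.setUidPl.
by rewrite finset.sub1set.
Qed.

Lemma card_U n u : (#|U n u| < K)%N.
Proof.
apply: leq_ltn_trans (_ : #|T n| + 1 < K)%N.
  by rewrite cardsU cards1 leq_subr.
by rewrite addn1; apply: leq_ltn_trans (_ : (K - 2).+1 < K)%N; rewrite ?ltnS //;
  case: K hK => [|[|[|]]] // k _; rewrite !subSS subn0.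
Qed.

Lemma explicit_single e : e \in explicit_set S -> exists m, S m = [set e].
Proof. by move=> /bigcupP[m _ em]; apply: (hS (m := m)); rewrite finset.sub1set. Qed.

Lemma explicit_sub m : S m \subset explicit_set S.
Proof. exact: finset.bigcup_sup. Qed.

Lemma diff_system m (A : {set 'I_K}) : exists m', S m' = S m :\: A.
Proof. exact/hS/finset.subsetDl. Qed.

Lemma empty_colluding : exists n, T n = finset.set0.
Proof. by apply: (hT (m := Ordinal hN)); rewrite finset.sub0set. Qed.

(** Normal form for the security bounds. If [U n u] swallows [S m], the explicit user [s] moves from
    [U n u] to a security set of its own; the size condition keeps the rest of [U n u] nonempty. *)
Lemma cover_normal m n u s : s \in explicit_set S -> s \in covered S T m n u ->
  (1 < #|covered S T m n u|)%N -> exists m' n' u',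
  [/\ S m' != finset.set0, forall x, x \in S m' -> x \notin U n' u' &
    S m' :|: U n' u' = covered S T m n u].
Proof.
move=> se sc c1; have [m0 em] := diff_system m (U n u).
have [S0|SN] := eqVneq (S m0) finset.set0; last first.
  exists m0, n, u; split=> //; first by move=> x; rewrite em !inE => /andP[].
  by rewrite em coveredE; apply/finset.setP => x; rewrite !inE; case: (_ || (x == u)); rewrite ?orbT //= orbF.
have cU : covered S T m n u = U n u.
  rewrite coveredE; apply/finset.setUidPr; rewrite -finset.setD_eq0 -em S0 //.
rewrite cU in sc c1 *.
have [m1 em1] := explicit_single se.
have [|n' [u' e]] := @colluding_sub (U n u :\ s) n u (finset.subD1set _ _).
  by rewrite -card_gt0; move: c1; rewrite (cardsD1 s) sc ltnS.
exists m1, n', u'; rewrite em1 e; split; last by rewrite finset.setD1K.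
  by apply/set0Pn; exists s; rewrite inE.
by move=> x; rewrite !inE => /eqP ->; rewrite eqxx.
Qed.

(** Removing [w] from [U n u] works unless [U n u] is [w] alone. Then [S m] is the complement of
    [w], and any of its members serves as decoder without colluders. *)
Lemma covered_drop m n u w : covered S T m n u = [set: 'I_K] -> w \notin S m ->
  exists m' n' u', covered S T m' n' u' = ~: [set w].
Proof.
move=> cT wS; have cov x : x \notin S m -> x \in U n u.
  by have := finset.in_setT x; rewrite -cT coveredE inE => /orP[->|].
have [E|EN] := eqVneq (U n u :\ w) finset.set0.
  have Sw : S m = ~: [set w].
    apply/finset.setP => x; rewrite !inE; have [->|xw] := eqVneq x w; first exact: negbTE.
    apply/idPn => xS; have : x \in U n u :\ w by rewrite finset.in_setD1 xw cov.
    by rewrite E inE.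
  have [s sS] : exists s, s \in S m.
    apply/set0Pn; rewrite Sw -card_gt0 cardsCs finset.setCK cards1 card_ord.
    by rewrite subn_gt0 (ltn_trans _ hK).
  have [n0 e0] := empty_colluding; exists m, n0, s.
  by rewrite coveredE e0 finset.set0U -Sw; apply/finset.setUidPl; rewrite finset.sub1set.
have [n' [u' e]] := @colluding_sub (U n u :\ w) n u (finset.subD1set _ _) EN.
exists m, n', u'; rewrite coveredE e; apply/finset.setP => x; rewrite !inE.
have [->|xw] /= := eqVneq x w; first by rewrite orbF (negbTE wS).
by apply/idP; case: (boolP (x \in S m)) => //= /cov; rewrite !inE.
Qed.

(** [covered_drop] makes any user that is not explicit the only uncovered one, hence implicit. *)
Lemma covered_full m n u : covered S T m n u = [set: 'I_K] -> Sbar = [set: 'I_K].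
Proof.
move=> cT; apply/finset.setP => w; rewrite !inE.
have [//|we] /= := boolP (w \in explicit_set S).
have [m' [n' [u' e]]] : exists m' n' u', covered S T m' n' u' = ~: [set w].
  apply: (covered_drop cT); apply: contra we; exact: (fintype.subsetP (explicit_sub m)).
apply/existsP; exists m'; apply/existsP; exists n'; apply/existsP; exists u'.
by rewrite e finset.setCK.
Qed.

Lemma leq_astar m n u : (#|covered_total S T m n u| <= astar S T)%N.
Proof.
rewrite /astar; apply: leq_trans (leq_bigmax m).
by apply: leq_trans (leq_bigmax n); apply: leq_trans (leq_bigmax u).
Qed.

Lemma extremal_exists : exists m n u, extremal S T m n u.
Proof.
have m0 : (0 < #|'I_M|)%N.
  by case/set0Pn: hS0 => x /bigcupP[m _ _]; rewrite card_ord (leq_ltn_trans _ (ltn_ord m)).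
have n0 : (0 < #|'I_N|)%N by rewrite card_ord.
have u0 : (0 < #|'I_K|)%N by rewrite card_ord (ltn_trans _ hK).
rewrite /extremal /astar.
have [m ->] := @bigop.eq_bigmax _ (fun m : 'I_M => \max_(n < N) \max_(u < K) #|covered_total S T m n u|)%N m0.
have [n ->] := @bigop.eq_bigmax _ (fun n : 'I_N => \max_(u < K) #|covered_total S T m n u|)%N n0.
have [u ->] := @bigop.eq_bigmax _ (fun u : 'I_K => #|covered_total S T m n u|)%N u0.
by exists m, n, u.
Qed.

(** If everything were covered, every user would be in the total set by [covered_full], and
    [astar S T] would be [K]. *)
Lemma extremal_notin m n u : extremal S T m n u -> astar S T != K ->
  exists v, v \notin covered S T m n u.
Proof.
move=> ext aK; have [cT|] := eqVneq (covered S T m n u) [set: 'I_K].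
  case/eqP: aK; move: ext; rewrite /extremal /covered_total (covered_full cT) cT.
  by rewrite finset.setIT cardsT card_ord => /eqP.
move=> cT; apply: exists_notin; rewrite -cardsT; apply: proper_card.
by rewrite finset.properEneq cT finset.subsetT.
Qed.

Lemma extremal_total m n u : extremal S T m n u -> astar S T = #|Sbar| ->
  Sbar \subset covered S T m n u.
Proof.
rewrite /extremal /covered_total => /eqP e1 e2.
apply/finset.setIidPr/eqP; rewrite eqEcard finset.subsetIr /=.
by rewrite e1 e2.
Qed.

(** * The lower bound on the source key, for a set function [kappa] standing for B |-> H(Z_B) *)

Section Converse.
Variables (R : realType) (L : R) (kappa : {set 'I_K} -> R).
Hypothesis L0 : 0 < L.
Hypothesis k_mono : forall A B : {set 'I_K}, A \subset B -> kappa A <= kappa B.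
Hypothesis k_sub : forall A B A1 A2 : {set 'I_K}, A \subset A1 :|: A2 -> B \subset A1 :&: A2 ->
  kappa A + kappa B <= kappa A1 + kappa A2.
Hypothesis k0 : kappa finset.set0 = 0.
Hypothesis k_hid : forall m n u v, v \notin S m :|: U n u ->
  (forall x, x \in S m -> x \notin U n u) ->
  #|S m|%:R * L <= kappa (S m :|: U n u) - kappa (U n u).
Hypothesis k_out : forall m n u x v, x \in S m -> v \notin S m :|: U n u ->
  (forall x, x \in S m -> x \notin U n u) -> L <= kappa (~: S m) - kappa (U n u).

Lemma k_ge0 A : 0 <= kappa A.
Proof. by rewrite -k0 k_mono // finset.sub0set. Qed.

(** By submodularity an element has at least the same increment over a smaller set as it has at [V],
    so the bounds add up. *)
Lemma peel (V E : {set 'I_K}) : (forall e, e \in E -> L <= kappa V - kappa (V :\ e)) ->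
  #|E|%:R * L <= kappa V - kappa (V :\: E).
Proof.
elim/set_ind: E => [|k D kD IH] VE; first by rewrite cards0 mul0r finset.setD0 subrr.
have := VE k; rewrite !inE eqxx => /(_ isT).
have := IH (fun e eD => VE e (fintype.subsetP (finset.subsetUr [set k] D) e eD)).
have : kappa V + kappa (V :\: (k |: D)) <= kappa (V :\: D) + kappa (V :\ k).
  by apply: k_sub; setsolve.
by rewrite cardsU1 kD natrD mulrDl mul1r; lra.
Qed.

Lemma explicit_key_aux e n u v : e \in explicit_set S -> e \notin U n u ->
  v \notin e |: U n u -> L <= kappa (e |: U n u) - kappa (U n u).
Proof.
move=> ee eU vN; have [m em] := explicit_single ee.
have := @k_hid m n u v; rewrite em cards1 mul1r; apply=> //.
by move=> x; rewrite inE => /eqP ->.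
Qed.

(** An explicit user forms a security set on its own, and what remains of [U n u] is again a decoder
    with colluders, so [k_hid] applies. *)
Lemma explicit_key e n u : e \in explicit_set S -> e \in U n u ->
  L <= kappa (U n u) - kappa (U n u :\ e).
Proof.
move=> ee eU; have [E|EN] := eqVneq (U n u :\ e) finset.set0; last first.
  have [n' [u' e']] := colluding_sub (finset.subD1set _ _) EN.
  have [|v vN] := @exists_notin _ (U n u); first by rewrite card_ord card_U.
  have := @explicit_key_aux e n' u' v ee; rewrite e' finset.setD1K // => H.
  by apply: H => //; rewrite !inE eqxx.
(* Without [e] no decoder is left. Another user [u'] steps in, with a third user [v] outside, and
   conditioning on the key of [u'] only lowers the entropy. *)
have eV : U n u = [set e] by rewrite -(finset.setD1K eU) E finset.setU0.
have [|u' u'e] := @exists_notin _ [set e]; first by rewrite cards1 card_ord (ltn_trans _ hK).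
have [|v vN] := @exists_notin _ [set e; u'].
  by rewrite cards2 card_ord (leq_ltn_trans _ hK) // ltnS leq_b1.
have [n0 e0] := empty_colluding.
have := @explicit_key_aux e n0 u' v ee; rewrite e0 finset.set0U => H.
have {}H : L <= kappa (e |: [set u']) - kappa [set u'].
  by apply: H => //; rewrite inE; move: u'e; rewrite inE eq_sym.
rewrite E k0 eV subr0; have : kappa (e |: [set u']) + kappa finset.set0 <= kappa [set e] + kappa [set u'].
  by apply: k_sub; rewrite ?finset.sub0set.
by rewrite k0; move: H; lra.
Qed.

(** [i] is the only user outside some covered set. In normal form the complement of [S m'] is then
    [i |: U n' u'], so [k_out] bounds the increment of [i] over [U n' u'], a set that contains
    [Q]. *)
Lemma implicit_key i (Q : {set 'I_K}) : i \in implicit_set S T ->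
  (forall x, x \in Q -> x \notin explicit_set S) -> i \notin Q ->
  L <= kappa (i |: Q) - kappa Q.
Proof.
rewrite !inE => /andP[ie /existsP[m /existsP[n /existsP[u /eqP ci]]]] Qe iQ.
have cE : covered S T m n u = ~: [set i] by rewrite -ci finset.setCK.
have /set0Pn[s se] := hS0.
have si : s != i by apply: contraNneq ie => <-.
have [||m' [n' [u' [/set0Pn[x xS] disj]]]] := @cover_normal m n u s se.
- by rewrite cE !inE.
- rewrite cE cardsCs finset.setCK cards1 card_ord.
  by case: K hK => [|[|[|]]].
rewrite cE => c'.
have iN : i \notin S m' :|: U n' u' by rewrite c' !inE eqxx.
have H := k_out xS iN disj.
have eS : ~: S m' = i |: U n' u'.
  apply/finset.setP => y; have := congr1 (fun A : {set 'I_K} => y \in A) c'; have := disj y.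
  rewrite !inE; case: (y \in S m') => /= [/(_ isT)/negbTE -> /esym/negbTE -> //|_ ->].
  by rewrite orbN.
have QU : Q \subset U n' u'.
  apply/fintype.subsetP => y yQ; have yi : y != i by apply: contraNneq iQ => <-.
  have : y \in ~: [set i] by rewrite !inE.
  rewrite -c' inE => /orP[yS|//].
  by case/negP: (Qe _ yQ); apply: (fintype.subsetP (explicit_sub m')).
have : kappa (i |: U n' u') + kappa Q <= kappa (i |: Q) + kappa (U n' u').
  by apply: k_sub; [setsolve | rewrite finset.subsetI QU andbT finset.subsetUr].
by rewrite -eS; move: H; lra.
Qed.

(** Chain rule: first [S m] minus [U n u], then the explicit users of [U n u], then its implicit
    ones. These parts are disjoint and fill [covered_total S T m n u]. *)
Lemma total_keys m n u v : v \notin covered S T m n u ->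
  #|covered_total S T m n u|%:R * L + kappa (U n u :\: Sbar) <= kappa [set: 'I_K].
Proof.
move=> vN; have [m0 em] := diff_system m (U n u).
have disj x : x \in S m0 -> x \notin U n u by rewrite em !inE => /andP[].
have vN0 : v \notin S m0 :|: U n u.
  by move: vN; rewrite coveredE em !inE; case: (v \in S m); rewrite ?andbF ?andbT.
have h1 := k_hid vN0 disj.
set V := U n u :\: explicit_set S.
have h2 : #|explicit_set S :&: U n u|%:R * L <= kappa (U n u) - kappa V.
  rewrite (_ : V = U n u :\: (explicit_set S :&: U n u)); last first.
    by rewrite finset.setDIr finset.setDv finset.setU0.
  by apply: peel => e; rewrite inE => /andP[]; exact: explicit_key.
have h3 : #|implicit_set S T :&: V|%:R * L <= kappa V - kappa (U n u :\: Sbar).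
  rewrite (_ : U n u :\: Sbar = V :\: (implicit_set S T :&: V)); last first.
    by rewrite finset.setDIr finset.setDv finset.setU0 finset.setDDl.
  apply: peel => i; rewrite inE => /andP[iI iV].
  rewrite -{1}(finset.setD1K iV); apply: implicit_key => //; last by rewrite !inE eqxx.
  by move=> x; rewrite !inE => /andP[_ /andP[]].
have h4 : kappa (S m0 :|: U n u) <= kappa [set: 'I_K] by rewrite k_mono // finset.subsetT.
have -> : #|covered_total S T m n u| =
  (#|S m0| + #|explicit_set S :&: U n u| + #|implicit_set S T :&: V|)%N.
  rewrite -(cardsID (U n u)) addnC -addnA; congr (_ + _)%N.
    rewrite em /covered_total coveredE; move: (U n u) => W; congr #|(_ : {set 'I_K})|.
    apply/finset.setP => x; rewrite !(finset.in_setD, finset.in_setI, finset.in_setU).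
    case: (x \in W) => //=; rewrite orbF; case: (boolP (x \in S m)) => //= xS.
    by rewrite (fintype.subsetP (explicit_sub m)).
  rewrite /V /covered_total coveredE; move: (U n u) => W.
  rewrite -(cardsID (explicit_set S)); congr (#|(_ : {set 'I_K})| + #|(_ : {set 'I_K})|)%N;
    apply/finset.setP => x; rewrite !(finset.in_setD, finset.in_setI, finset.in_setU);
    by case: (x \in explicit_set S); case: (x \in W); rewrite ?orbT ?andbF ?andbT.
by rewrite !natrD !mulrDl; move: h1 h2 h3 h4; lra.
Qed.

(** [k_out] compares the complement of a security set with a set U'. Users of that complement
    outside U' are not covered, hence outside the total set, so submodularity carries the bound
    there. It becomes the constraint of the linear program. *)
Lemma outside_total m n u v : extremal S T m n u -> astar S T = #|Sbar| ->
  v \notin covered S T m n u ->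
  L <= kappa (~: Sbar) - kappa (U n u :\: Sbar).
Proof.
move=> ext aS vN; have Scov := extremal_total ext aS.
have /set0Pn[s se] := hS0.
have sS : s \in Sbar by rewrite inE se.
have sc := fintype.subsetP Scov s sS.
suff [A [B [H AB BU]]] : exists A B : {set 'I_K}, [/\ L <= kappa A - kappa B,
    A \subset ~: Sbar :|: B & U n u :\: Sbar \subset B].
  have : kappa A + kappa (U n u :\: Sbar) <= kappa (~: Sbar) + kappa B.
    apply: k_sub => //; rewrite finset.subsetI BU andbT.
    by apply/fintype.subsetP => x; rewrite finset.in_setD finset.in_setC => /andP[].
  by move: H; lra.
have [c1|c1] := ltnP 1 #|covered S T m n u|.
  have [m' [n' [u' [/set0Pn[x xS] disj c']]]] := cover_normal se sc c1.
  exists (~: S m'), (U n' u'); split; first by apply: (@k_out _ _ _ x v) => //; rewrite c'.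
    apply/fintype.subsetP => y; rewrite finset.in_setC finset.in_setU finset.in_setC => yS.
    case: (boolP (y \in Sbar)) => //= /(fintype.subsetP Scov).
    by rewrite -c' inE (negbTE yS).
  apply/fintype.subsetP => y; rewrite finset.in_setD => /andP[yS yU].
  have : y \in covered S T m n u by rewrite coveredE inE yU orbT.
  rewrite -c' inE => /orP[ySm|//]; case/negP: yS; rewrite inE.
  by rewrite (fintype.subsetP (explicit_sub m')).
(* The covered set is too small for [cover_normal]; the single user [s] is hidden from some other
   user [u'] instead. *)
have cs : covered S T m n u = [set s].
  by apply/eqP; rewrite eq_sym eqEcard finset.sub1set sc cards1.
have [m1 em1] := explicit_single se.
have [n0 e0] := empty_colluding.
have [|u' u's] := @exists_notin _ [set s]; first by rewrite cards1 card_ord (ltn_trans _ hK).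
have [|w wN] := @exists_notin _ [set s; u'].
  by rewrite cards2 card_ord (leq_ltn_trans _ hK) // ltnS leq_b1.
exists (~: S m1), (U n0 u'); rewrite e0 finset.set0U; split.
- have := @k_out m1 n0 u' s w; rewrite em1 e0 finset.set0U inE eqxx; apply=> //.
  by move=> x; rewrite !inE => /eqP ->; rewrite eq_sym; rewrite inE in u's.
- apply/fintype.subsetP => y; rewrite em1 !finset.in_setC finset.in_setU finset.in_setC => ys.
  rewrite (contra _ ys) // => /(fintype.subsetP Scov); by rewrite cs.
apply/fintype.subsetP => y; rewrite finset.in_setD => /andP[yS yU].
have : y \in covered S T m n u by rewrite coveredE inE yU orbT.
by rewrite cs inE => /eqP ys; rewrite ys sS in yS.
Qed.

(** [total_keys] needs an uncovered user, so [covered_drop] frees the decoder [u]; the other K - 1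
    users stay covered, and all of them are in the total set. *)
Lemma full_keys : astar S T = K -> (K - 1)%:R * L <= kappa [set: 'I_K].
Proof.
move=> aK; have [m [n [u]]] := extremal_exists.
rewrite /extremal aK => /eqP cK.
have cT : covered_total S T m n u = [set: 'I_K].
  by apply/eqP; rewrite eqEcard finset.subsetT cardsT card_ord cK leqnn.
have coT : covered S T m n u = [set: 'I_K].
  by apply/eqP; rewrite -finset.subTset -cT finset.subsetIl.
have [m0 em] := diff_system m (U n u).
have [||m' [n' [u' c']]] := @covered_drop m0 n u u.
- rewrite coveredE em -coT coveredE; apply/finset.setP => x; rewrite !inE.
  by case: (_ || (x == u)); rewrite ?orbT //= orbF.
- by rewrite em !inE eqxx orbT.
have := @total_keys m' n' u' u; rewrite c' !inE eqxx => /(_ isT).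
rewrite /covered_total c' (covered_full coT) finset.setIT cardsCs finset.setCK cards1 card_ord.
by move: (k_ge0 (U n' u' :\: [set: 'I_K])); lra.
Qed.

Lemma Rstar_keys : Rstar R S T * L <= kappa [set: 'I_K].
Proof.
have [m [n [u ext]]] := extremal_exists.
rewrite /Rstar; case: eqVneq => [/full_keys //|aK].
have bound : (astar S T)%:R * L <= kappa [set: 'I_K].
  have [v /total_keys] := extremal_notin ext aK; move: ext; rewrite /extremal => /eqP ->.
  by move: (k_ge0 (U n u :\: Sbar)); lra.
case: ifP => [//|/negbT]; rewrite negb_or -leqNgt => /andP[Sa _].
have aS : astar S T = #|Sbar|.
  apply/eqP; rewrite eqn_leq Sa andbT; move: ext; rewrite /extremal => /eqP <-.
  by apply/subset_leq_card/finset.subsetIr.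
have k_sub' (A B : {set 'I_K}) : kappa (A :|: B) + kappa (A :&: B) <= kappa A + kappa B.
  exact: k_sub.
(* Divided by [L], the greedy marginals outside the total set are the weights for the linear
   program. *)
have [b [b0 bP bD]] := polymatroid_base (~: Sbar) k0 k_mono k_sub'.
have outE m' n' u' : extremal S T m' n' u' ->
    U n' u' :\: Sbar = ~: Sbar :\: ~: covered S T m' n' u'.
  have SmS : S m' \subset Sbar.
    exact: fintype.subset_trans (explicit_sub m') (finset.subsetUl _ _).
  move=> _; rewrite coveredE; move: (Sbar) SmS (U n' u') => B SmS W.
  apply/finset.setP => x; rewrite !(finset.in_setD, finset.in_setC, finset.in_setU) negbK.
  case: (boolP (x \in S m')) => [xS|_] /=; last by rewrite andbC.
  by rewrite (fintype.subsetP SmS _ xS).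
(* The weights [b] sum to [kappa (~: Sbar)], of which [U n' u' :\: Sbar] takes at most its own
   [kappa]; by [outside_total] at least [L] is left for the uncovered users. *)
have feas : lp_feasible S T (fun k => b k / L).
  split=> [m' n' u' ext'|k _]; last by rewrite divr_ge0 // ltW.
  have [v vN] := extremal_notin ext' aK.
  have H := outside_total ext' aS vN.
  have Scov := extremal_total ext' aS.
  rewrite -mulr_suml ler_pdivlMr // mul1r; apply: le_trans H _.
  rewrite -bD (big_setID (~: covered S T m' n' u')) /= -outE //.
  rewrite (_ : _ :&: _ = ~: covered S T m' n' u'); last first.
    by apply/finset.setIidPr; rewrite finset.setCS.
  have := bP (U n' u' :\: Sbar); rewrite finset.setDE finset.subsetIr => /(_ isT); lra.
have obj : lp_objective S T (fun k => b k / L) <= kappa [set: 'I_K] / L - (astar S T)%:R.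
  (* The default value 0 of the maximum has to lie below the bound too. *)
  have base : 0 <= kappa [set: 'I_K] / L - (astar S T)%:R.
    by rewrite subr_ge0 ler_pdivlMr.
  apply: bigmax_le => // m' _; apply: bigmax_le => // n' _; apply: bigmax_le => // u' ext'.
  rewrite -mulr_suml lerBrDr -(ler_pM2r L0) mulrDl !divfK ?lt0r_neq0 //.
  have [v /total_keys] := extremal_notin ext' aK; move: (ext'); rewrite /extremal => /eqP ->.
  have := bP (U n' u' :\: Sbar); rewrite finset.setDE finset.subsetIr => /(_ isT); lra.
have : bstar R S T <= lp_objective S T (fun k => b k / L).
  apply: ge_inf; last by exists (fun k => b k / L).
  exists 0 => _ [c _ <-]; exact: bigmax_ge_id.
move=> H; rewrite -ler_pdivlMr //; move: obj H; lra.
Qed.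

End Converse.
End SetSystems.


Lemma converse (R : realType) (K M N : nat)
    (S : 'I_M -> {set 'I_K}) (T : 'I_N -> {set 'I_K})
    (hK : (3 <= K)%N) (hN : (0 < N)%N)
    (hS : monotone_system S) (hT : monotone_system T)
    (hS0 : (\bigcup_(m < M) S m)%SET != finset.set0)
    (hT2 : forall n, (#|T n| <= K - 2)%N) (r : R * R) :
  achievable S T r -> 1 <= r.1 /\ Rstar R S T <= r.2.
Proof.
move=> [s [cor sec r1 r2]]; have K1 : (1 < K)%N by exact: ltn_trans hK.
have L0 : 0 < (input_len s)%:R :> R by rewrite ltr0n input_len_gt0.
split.
  apply: le_trans r1; rewrite /message_rate ler_pdivlMr // mul1r.
  exact: message_len_ge.
apply: le_trans r2; rewrite /source_key_rate ler_pdivlMr //.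
apply: le_trans (bundle_keys s).
pose kappa B := bundle_entropy s finset.set0 B finset.set0 false.
apply: (@Rstar_keys K M N S T hK hN hS hT hS0 hT2 R _ kappa) => //.
- by move=> A B AB; apply: bundle_mono.
- by move=> A B A1 A2 ? ?; apply: bundle_sub; rewrite ?finset.sub0set.
- exact: bundle0.
- by move=> m n u v ? ?; apply: (keys_hidden K1 cor sec (v := v)).
- by move=> m n u x v ? ? ?; apply: (keys_outside K1 cor sec (x := x) (v := v)).
Qed.

(** * Linear schemes *)

Section Mass.
Variables (R : realType) (O : finType) (mu : O -> R) (q : nat).
Hypotheses (mu_ge0 : forall w, 0 <= mu w) (mu_sum1 : \sum_w mu w = 1).
Hypothesis (q_gt1 : (1 < q)%N).

Lemma sum_rv_mass1 (A : finType) (X : O -> A) : \sum_a rv_mass mu X a = 1.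
Proof.
rewrite -mu_sum1 -[RHS](eq_bigr _ (fun w _ => mulr1 (mu w))) -(sum_rv_mass mu X (fun=> 1)).
by apply: eq_bigr => a _; rewrite mulr1.
Qed.

Lemma rv_mass_const (A : finType) (X : O -> A) (a : A) :
  (forall a', rv_mass mu X a' = rv_mass mu X a) -> rv_mass mu X a = (#|A|%:R)^-1.
Proof.
move=> cst; have := sum_rv_mass1 X; under eq_bigr do rewrite cst.
rewrite sumr_const -[_ *+ _]mulr_natl => e.
have A0 : #|A|%:R != 0 :> R by apply/eqP => A0; move/eqP: e; rewrite A0 mul0r eq_sym oner_eq0.
by apply: (mulfI A0); rewrite e mulfV.
Qed.

Lemma cond_entropy0 (A B : finType) (X : O -> A) (Y : O -> B) :
  refines X Y -> cond_entropy mu q X Y = 0.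
Proof.
move=> XY; rewrite (cond_entropyE _ mu_ge0) (@eq_entropy _ _ _ _ mu_ge0 q_gt1 _ _ _ Y) ?subrr //.
  by move=> w w' e; rewrite /joint e (XY _ _ e).
by move=> w w' [].
Qed.

(** Given Y, the values of W compatible with Y are equally likely together with every x, so X does
    not change the conditional law of W. *)
Lemma cond_mutual_info0 (A B C : finType) (W : O -> A) (X : O -> B) (Y : O -> C) :
  (forall w w' x, Y w = Y w' ->
     rv_mass mu (joint W (joint X Y)) (W w, (x, Y w))
     = rv_mass mu (joint W (joint X Y)) (W w', (x, Y w))) ->
  cond_mutual_info mu q W X Y = 0.
Proof.
move=> inv; rewrite /cond_mutual_info !(cond_entropyE _ mu_ge0) !entropyE.
rewrite !opprK -!sumrN -!big_split -sumrN -big_split /= big1 // => w _.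
have [->|w0] := eqVneq (mu w) 0; first by rewrite !(mul0r, oppr0, addr0).
have wp : 0 < mu w by rewrite lt_def w0 mu_ge0.
(* The masses of (X, Y) and of Y are [n] times the joint ones with W, so [n] cancels among the four
   logarithms. *)
pose n : R := #|[set a : A | [exists w', (Y w' == Y w) && (W w' == a)]]|%:R.
have exy x : rv_mass mu (joint X Y) (x, Y w) =
    n * rv_mass mu (joint W (joint X Y)) (W w, (x, Y w)).
  rewrite -(marginal mu W) mulr_natl -sumr_const big_mkcond [RHS]big_mkcond /=.
  apply: eq_bigr => a _; rewrite inE; case: existsP => [[w' /andP[/eqP e /eqP <-]]|no].
    by rewrite (inv w w').
  rewrite /rv_mass big1 // => w' /eqP[e1 _ e2]; case: no.
  by exists w'; rewrite e1 e2 !eqxx.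
have margX a : \sum_x rv_mass mu (joint W (joint X Y)) (a, (x, Y w)) = rv_mass mu (joint W Y) (a, Y w).
  rewrite -(marginal mu X (joint W Y)); apply: eq_bigr => x _; apply: eq_bigl => w'.
  by rewrite !xpair_eqE; do 3 case: eqP => //=.
have ey : rv_mass mu Y (Y w) = n * rv_mass mu (joint W Y) (W w, Y w).
  rewrite -(marginal mu X Y) -margX mulr_sumr; apply: eq_bigr => x _; exact: exy.
have p1 := rv_mass_gt0 mu_ge0 (joint W (joint X Y)) wp.
have p2 := rv_mass_gt0 mu_ge0 (joint W Y) wp.
have n0 : 0 < n.
  rewrite ltr0n card_gt0; apply/set0Pn; exists (W w); rewrite inE.
  by apply/existsP; exists w; rewrite !eqxx.
move: p1 p2; rewrite -[joint W Y w]/(W w, Y w) -[joint X Y w]/(X w, Y w).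
rewrite -[joint W (joint X Y) w]/(W w, (X w, Y w)) exy ey => p1 p2.
by rewrite /logb !lnM ?posrE //; ring.
Qed.

End Mass.

(** * Additive masking of the inputs by keys linear in a uniform source key *)

Section LinearScheme.
Variables (R : realType) (K : nat) (F : finFieldType) (L D : nat).
Variable Phi : 'I_K -> 'M[F]_(D, L).
Hypothesis L_gt0 : (0 < L)%N.
Hypothesis Phi_sum : \sum_k Phi k = 0.

Let O : finType := ({ffun 'I_K -> 'rV[F]_L} * 'rV[F]_D)%type.
Let lmu (_ : O) : R := #|O|%:R^-1.
Let linput (k : 'I_K) (w : O) := w.1 k.
Let lkey (k : 'I_K) (w : O) := w.2 *m Phi k.
Let lsource (w : O) := w.2.
Let lmessage (k : 'I_K) (w : O) := w.1 k + w.2 *m Phi k.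

Let shift (d : O) (w : O) : O := ([ffun k => w.1 k + d.1 k], w.2 + d.2).

Lemma shift_bij d : bijective (shift d).
Proof.
exists (shift ([ffun k => - d.1 k], - d.2)) => -[w z]; rewrite /shift /=; congr (_, _);
  rewrite ?addrK ?subrK //; by apply/ffunP => k; rewrite !ffunE ?addrK ?subrK.
Qed.

(** The uniform law is invariant under translation, so two values have equal mass once a translation
    matches their events. All laws of the scheme are compared this way. *)
Lemma rv_mass_shift (A : finType) (X : O -> A) a a' d :
  (forall w, (X (shift d w) == a') = (X w == a)) -> rv_mass lmu X a = rv_mass lmu X a'.
Proof.
move=> e; rewrite /rv_mass [RHS](reindex (shift d)) /=; last exact/onW_bij/shift_bij.
by apply: eq_bigl => w; rewrite e.
Qed.

Lemma card_O_gt0 : (0 < #|O|)%N.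
Proof. by apply/card_gt0P; exists ([ffun => 0], 0). Qed.

Lemma lmu_ge0 w : 0 <= lmu w.
Proof. by rewrite invr_ge0 ler0n. Qed.

Lemma lmu_sum1 : \sum_w lmu w = 1.
Proof. by rewrite sumr_const -[_ *+ _]mulr_natl mulfV // pnatr_eq0 -lt0n card_O_gt0. Qed.

Lemma linput_uniform k x : rv_mass lmu (linput k) x = (#|F|%:R ^+ L)^-1.
Proof.
rewrite (rv_mass_const lmu_sum1); first by rewrite card_mx mul1n natrX.
move=> x'; symmetry; apply: (@rv_mass_shift _ _ _ _ ([ffun => x' - x], 0)) => w.
rewrite /linput /shift /= !ffunE.
by rewrite [X in _ == X](_ : x' = x + (x' - x)) ?(inj_eq (addIr _)) // addrC subrK.
Qed.

Lemma lfst_uniform x : rv_mass lmu fst x = (#|F|%:R ^+ L)^-1 ^+ K.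
Proof.
rewrite (rv_mass_const lmu_sum1).
  by rewrite card_ffun card_ord card_mx mul1n natrX natrX exprVn.
move=> x'; symmetry; apply: (@rv_mass_shift _ _ _ _ ([ffun k => x' k - x k], 0)) => w.
apply/eqP/eqP => [|wx]; last by apply/ffunP => k; rewrite /shift /= !ffunE wx addrC subrK.
move/ffunP => e; apply/ffunP => k; apply: (addIr (x' k - x k)).
by have := e k; rewrite /shift /= !ffunE => ->; rewrite addrC subrK.
Qed.

Lemma linput_indep (x : 'I_K -> 'rV[F]_L) :
  \sum_(w | [forall k, linput k w == x k]) lmu w = \prod_(k < K) rv_mass lmu (linput k) (x k).
Proof.
under [RHS]eq_bigr do rewrite linput_uniform.
rewrite prodr_const card_ord -(lfst_uniform [ffun k => x k]); apply: eq_bigl => w.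
apply/forallP/eqP => [e|e k]; last by rewrite /linput e ffunE.
by apply/ffunP => k; rewrite ffunE; apply/eqP/e.
Qed.

Local Notation q := #|F|.

Lemma linput_key_indep :
  entropy lmu q (joint (family_on [set: 'I_K] linput) (family_on [set: 'I_K] lkey))
  = \sum_(k < K) entropy lmu q (linput k) + entropy lmu q (family_on [set: 'I_K] lkey).
Proof.
have q1 : (1 < q)%N := card_finNzRing_gt1 F.
under eq_bigr do rewrite (entropy_uniform (linput_uniform _)).
rewrite sumr_const card_ord.
set Z := family_on _ lkey.
rewrite (@eq_entropy _ _ _ _ lmu_ge0 q1 _ _ _ (joint fst Z)); first last.
- by move=> w w' [/family_onP e1 e2]; rewrite /joint e2; congr (_, _); apply/ffunP => k; exact: e1.
- by move=> w w' [e1 e2]; rewrite /joint e2; congr (_, _); apply/family_onP => k _; rewrite /linput e1.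
(* Translating the inputs leaves the keys alone, so all input families are equally likely jointly
   with [z]. *)
have mE w z : rv_mass lmu (joint fst Z) (w, z) = (q%:R ^+ L)^-1 ^+ K * rv_mass lmu Z z.
  rewrite -(marginal lmu fst Z) (eq_bigr (fun=> rv_mass lmu (joint fst Z) (w, z))).
    have -> : (q%:R ^+ L)^-1 ^+ K = #|{ffun 'I_K -> 'rV[F]_L}|%:R^-1 :> R.
      rewrite -(lfst_uniform w); apply: (rv_mass_const lmu_sum1) => a'.
      by rewrite !lfst_uniform.
    rewrite sumr_const -[rv_mass _ _ _ *+ _]mulr_natl mulrA mulVf ?mul1r // pnatr_eq0 -lt0n.
    by apply/card_gt0P; exists w.
  move=> w' _; symmetry; apply: (@rv_mass_shift _ _ _ _ ([ffun k => w' k - w k], 0)) => v.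
  have ZE : Z (shift ([ffun k => w' k - w k], 0) v) = Z v.
    by apply/family_onP => k _; rewrite /lkey /= addr0.
  rewrite /joint !xpair_eqE ZE; congr (_ && _).
  apply/eqP/eqP => [|wx]; last by apply/ffunP => k; rewrite /shift /= !ffunE wx addrC subrK.
  move/ffunP => e; apply/ffunP => k; apply: (addIr (w' k - w k)).
  by have := e k; rewrite /shift /= !ffunE => ->; rewrite addrC subrK.
rewrite !entropyE (eq_bigr (fun w => lmu w * (- (L%:R *+ K) + logb q (rv_mass lmu Z (Z w))))); last first.
  move=> w _; rewrite mE; congr (_ * _).
  have wp : 0 < lmu w by rewrite invr_gt0 ltr0n card_O_gt0.
  have p2 := rv_mass_gt0 lmu_ge0 Z wp.
  have q0 : 0 < q%:R :> R by rewrite ltr0n ltnW.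
  rewrite {1}/logb lnM ?posrE ?exprn_gt0 ?invr_gt0 ?exprn_gt0 // mulrDl; congr (_ + _).
  rewrite exprVn -exprM lnV ?posrE ?exprn_gt0 // mulNr; congr (- _).
  by rewrite -[LHS]/(logb q (q%:R ^+ (L * K))) logb_exp // natrM mulr_natr.
under eq_bigr do rewrite mulrDr.
by rewrite big_split /= -mulr_suml lmu_sum1 mul1r opprD opprK.
Qed.

Lemma lkey_of_source : cond_entropy lmu q (family_on [set: 'I_K] lkey) lsource = 0.
Proof.
apply: cond_entropy0; [exact: lmu_ge0 | exact: card_finNzRing_gt1 |].
by move=> w w' e; apply/family_onP => k _; rewrite /lkey -[w.2]/(lsource w) e.
Qed.

Lemma lmessage_local k : cond_entropy lmu q (lmessage k) (joint (linput k) (lkey k)) = 0.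
Proof.
apply: cond_entropy0; [exact: lmu_ge0 | exact: card_finNzRing_gt1 |].
by move=> w w' [e1 e2]; rewrite /lmessage -[w.1 k]/(linput k w) -/(lkey k w) e1 e2.
Qed.

Definition linear_scheme : scheme R K :=
  @Scheme R K F L L D _ O lmu linput lsource lkey lmessage L_gt0 lmu_ge0 lmu_sum1
    linput_uniform linput_indep linput_key_indep lkey_of_source lmessage_local.

(** The keys sum to 0, so the sum of the inputs is the sum of the other messages plus the input and
    the key of [u]. *)
Lemma linear_correct : correct linear_scheme.
Proof.
move=> u; apply: cond_entropy0; [exact: lmu_ge0 | exact: card_finNzRing_gt1 |].
move=> w w' [/family_onP e1 e2 e3].
suff sumE v : @input_sum R K linear_scheme v =
   \sum_(k | k != u) lmessage k v + linput u v + lkey u v.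
  have e4 : linput u w = linput u w' := e2.
  have e5 : lkey u w = lkey u w' := e3.
  rewrite !sumE e4 e5; congr (_ + _ + _); apply: eq_bigr => k ku; apply: e1.
  by rewrite !inE.
have : \sum_k lkey k v = 0 by rewrite /lkey -mulmx_sumr Phi_sum mulmx0.
rewrite (bigD1 u) //= => /eqP; rewrite addr_eq0 => /eqP ->.
rewrite big_split /= /input_sum (bigD1 u) //=.
have aux (a b c : 'rV[F]_L) : a + b = b + c + a - c.
  by rewrite [RHS]addrAC addrK addrC.
exact: aux.
Qed.

Section Secure.
Variables (M N : nat) (S : 'I_M -> {set 'I_K}) (T : 'I_N -> {set 'I_K}).
Hypothesis Phi_secure : forall m n u (delta : 'I_K -> 'rV[F]_L),
  (forall k, k \in T n :|: [set u] -> delta k = 0) -> \sum_k delta k = 0 ->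
  exists z : 'rV[F]_D, (forall k, k \in T n :|: [set u] -> z *m Phi k = 0)
    /\ (forall k, k \in S m -> z *m Phi k = delta k).

(** Outcomes that agree on the conditioning variable differ by some [delta] in the inputs. Adding
    [z] to the source key and subtracting its keys from the inputs moves W_S from one value to the
    other, while the messages, the sum and the data of the colluders and decoder stay fixed. *)
Lemma linear_secure : secure S T linear_scheme.
Proof.
move=> m n u; apply: cond_mutual_info0; first exact: lmu_ge0.
set W := family_on (S m) _; set X := messages_except _; set Y := joint _ _ => w w' x e.
have e1 : \sum_k w.1 k = \sum_k w'.1 k := congr1 fst e.
have e2 : w.1 u = w'.1 u := congr1 (fun x => x.2.1.1) e.
have /family_onP e4 := congr1 (fun x => x.2.2) e.
have [||z [zU zS]] := @Phi_secure m n u (fun k => w.1 k - w'.1 k).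
- move=> k; rewrite !inE => /orP[/e4 [e5 _]|/eqP ->]; last by rewrite e2 subrr.
  by have -> : w.1 k = w'.1 k := e5; rewrite subrr.
- by rewrite sumrB e1 subrr.
apply: (@rv_mass_shift _ _ _ _ ([ffun k => - (z *m Phi k)], z)) => v.
set v' := shift _ v.
have iE k : v'.1 k = v.1 k - z *m Phi k by rewrite /v' /shift /= !ffunE.
have kE k : v'.2 *m Phi k = v.2 *m Phi k + z *m Phi k by rewrite /v' /shift /= mulmxDl.
have XE : X v' = X v.
  by apply/family_onP => k _; rewrite /= /lmessage iE kE addrCA subrK addrC.
have YE : Y v' = Y v.
  rewrite /Y /joint /=; congr (_, (_, _)).
  - rewrite /input_sum /= /linput; under eq_bigr do rewrite iE.
    by rewrite sumrB -mulmx_sumr Phi_sum mulmx0 subr0.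
  - by rewrite /linput /lkey iE kE zU ?subr0 ?addr0 // !inE eqxx orbT.
  - apply/family_onP => k kT; rewrite /joint /= /linput /lkey iE kE zU ?subr0 ?addr0 //.
    by rewrite inE kT.
rewrite -[joint W (joint X Y) v']/(W v', (X v', Y v')) XE YE.
rewrite -[joint W (joint X Y) v]/(W v, (X v, Y v)) !xpair_eqE; congr (_ && _).
apply/eqP/eqP => /family_onP e5; apply/family_onP => k kS; have := e5 k kS.
  rewrite /= /linput iE zS // => e6; apply: (subIr (w.1 k - w'.1 k)).
  by rewrite e6 subKr.
by rewrite /= /linput iE zS // => ->; rewrite subKr.
Qed.

Lemma linear_achievable (r : R * R) : 1 <= r.1 -> D%:R / L%:R <= r.2 -> achievable S T r.
Proof.
move=> r1 r2; exists linear_scheme; split=> //; first exact: linear_correct.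
  exact: linear_secure.
by rewrite /message_rate /= divff // pnatr_eq0 -lt0n.
Qed.

End Secure.
End LinearScheme.

(** * Vandermonde constructions *)

Lemma exists_distinct_points (I : finType) : exists (F : finFieldType) (alpha : I -> F),
  injective alpha.
Proof.
have [p Ip p_pr] := prime_above #|I|.
exists 'F_p, (fun i => (enum_rank i)%:R) => i j /(congr1 val).
rewrite /= !val_Fp_nat // !modn_small; try exact: ltn_trans (ltn_ord _) Ip.
by move/val_inj/enum_rank_inj.
Qed.

(** The MDS property: any [r] points of [V] give an invertible Vandermonde matrix, so coordinates
    supported there meet [r] prescribed checks. *)
Lemma vandermonde_solve (F : fieldType) (I : finType) (alpha : I -> F) (V : {set I}) r
    (tau : nat -> F) : injective alpha -> (r <= #|V|)%N ->
  exists y : I -> F, (forall i, i \notin V -> y i = 0) /\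
    forall j, (j < r)%N -> \sum_i y i * alpha i ^+ j = tau j.
Proof.
move=> alpha_inj rV; pose f (a : 'I_r) : I := enum_val (widen_ord rV a).
have f_inj : injective f by move=> a b /enum_val_inj /(congr1 val) /= /val_inj.
pose W := Vandermonde r (\row_a alpha (f a)).
have Wu : W \in unitmx.
  rewrite unitmxE det_Vandermonde unitfE; apply/prodf_neq0 => i _; apply/prodf_neq0 => j ij.
  rewrite !mxE subr_eq0; apply: contraTneq ij => /alpha_inj/f_inj ->; by rewrite ltnn.
pose Y := invmx W *m (\col_(j < r) tau j).
exists (fun i => \sum_(a | f a == i) Y a 0); split.
  move=> i iV; rewrite big1 // => a /eqP fa; case/negP: iV.
  by rewrite -fa /f; have := enum_valP (widen_ord rV a).
move=> j jr; transitivity (\sum_a Y a 0 * alpha (f a) ^+ j).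
  rewrite [RHS](partition_big f xpredT) //=; apply: eq_bigr => i _.
  by rewrite mulr_suml; apply: eq_bigr => a /eqP ->.
have := congr1 (fun A : 'cV_r => A (Ordinal jr) 0) (mulKVmx Wu (\col_(j < r) tau j)).
rewrite -/Y !mxE /= => <-; apply: eq_bigr => a _.
by rewrite !mxE mulrC.
Qed.

(** Surjectivity says that the [r] checks are independent, so their kernel has dimension |I| - r. *)
Lemma kernel_basis (F : fieldType) (I : finType) r (C : I -> nat -> F) :
  (forall tau : nat -> F, exists x : I -> F,
     forall j, (j < r)%N -> \sum_i x i * C i j = tau j) ->
  exists D (B : 'I_D -> I -> F), [/\ (D + r = #|I|)%N,
    forall d j, (j < r)%N -> \sum_i B d i * C i j = 0 &
    forall x : I -> F, (forall j, (j < r)%N -> \sum_i x i * C i j = 0) ->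
      exists z : 'rV[F]_D, forall i, x i = \sum_d z 0 d * B d i].
Proof.
move=> surj; pose A : 'M[F]_(#|I|, r) := \matrix_(a, j) C (enum_val a) j.
have sumE (x : I -> F) j : ((\row_a x (enum_val a)) *m A) 0 j = \sum_i x i * C i j.
  rewrite mxE [RHS](reindex (fun a : 'I_#|I| => enum_val a)) /=; last exact/onW_bij/enum_val_bij.
  by apply: eq_bigr => a _; rewrite !mxE.
have Ar : \rank A = r.
  apply/eqP; rewrite -[_ == _]/(row_full A) -sub1mx; apply/row_subP => i.
  have [x xP] := surj (fun j => (j == i :> nat)%:R).
  apply/submxP; exists (\row_a x (enum_val a)); apply/rowP => j.
  by rewrite sumE xP // !mxE eq_sym.
exists (\rank (kermx A)), (fun d i => row_base (kermx A) d (enum_rank i)); split.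
- by rewrite mxrank_ker Ar subnK // -Ar rank_leq_row.
- move=> d j jr; have : row d (row_base (kermx A)) *m A = 0.
    by apply/sub_kermxP; apply: submx_trans (row_sub _ _) _; rewrite eq_row_base.
  move/rowP/(_ (Ordinal jr)); rewrite mxE [X in _ = X -> _]mxE => e; apply: etrans e.
  rewrite [LHS](reindex (fun a : 'I_#|I| => enum_val a)) /=; last exact/onW_bij/enum_val_bij.
  by apply: eq_bigr => a _; rewrite !mxE enum_valK.
move=> x xP; have /submxP[z zP] : (\row_a x (enum_val a) <= row_base (kermx A))%MS.
  rewrite eq_row_base; apply/sub_kermxP/rowP => j.
  by rewrite sumE xP // mxE.
exists z => i; have := congr1 (fun v : 'rV_ _ => v 0 (enum_rank i)) zP.
by rewrite !mxE enum_rankK.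
Qed.

(** * Schemes whose keys come from the kernel of parity checks *)

Section Kernel.
Variables (R : realType) (K M N : nat) (S : 'I_M -> {set 'I_K}) (T : 'I_N -> {set 'I_K}).

(** Symbol [j] of the key of [k] is the part of check [j] on the coordinates that [k] owns. The keys
    sum to 0 since [L <= r], and the source key holds the |I| - r coefficients of a kernel vector in
    a basis. *)
Lemma kernel_achievable (F : finFieldType) (I : finType) (L r : nat) (C : I -> nat -> F)
    (owner : I -> 'I_K) (rate : R * R) :
  (0 < L)%N -> (L <= r)%N ->
  (forall tau : nat -> F, exists x : I -> F,
     forall j, (j < r)%N -> \sum_i x i * C i j = tau j) ->
  (forall m n u (delta : 'I_K -> 'rV[F]_L),
     (forall k, k \in T n :|: [set u] -> delta k = 0) -> \sum_k delta k = 0 ->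
     exists x : I -> F, [/\ forall j, (j < r)%N -> \sum_i x i * C i j = 0,
       forall k (j : 'I_L), k \in T n :|: [set u] ->
         \sum_(i | owner i == k) x i * C i j = 0 &
       forall k (j : 'I_L), k \in S m -> \sum_(i | owner i == k) x i * C i j = delta k 0 j]) ->
  1 <= rate.1 -> (#|I| - r)%N%:R / L%:R <= rate.2 -> achievable S T rate.
Proof.
move=> L0 Lr surj sec r1 r2; have [D [B [Dr B0 Bspan]]] := kernel_basis surj.
pose Phi k : 'M[F]_(D, L) := \matrix_(d, j) \sum_(i | owner i == k) B d i * C i j.
have PhiE x (z : 'rV[F]_D) k j : (forall i, x i = \sum_d z 0 d * B d i) ->
    (z *m Phi k) 0 j = \sum_(i | owner i == k) x i * C i j.
  move=> xE; rewrite mxE; under eq_bigr do rewrite mxE mulr_sumr.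
  rewrite exchange_big /=; apply: eq_bigr => i _; rewrite xE mulr_suml.
  by apply: eq_bigr => d _; rewrite mulrA.
apply: (@linear_achievable R K F L D Phi) => //.
- apply/matrixP => d j; rewrite summxE mxE; under eq_bigr do rewrite mxE.
  by rewrite -[RHS](B0 d j) ?(leq_trans (ltn_ord j)) // [RHS](partition_big owner xpredT).
- move=> m n u delta dU d0; have [x [x0 xU xS]] := sec m n u delta dU d0.
  have [z zE] := Bspan x x0; exists z; split=> k kA; apply/rowP => j; rewrite (PhiE x) //.
    by rewrite xU // mxE.
  by rewrite xS.
by rewrite -(addnK r D) Dr.
Qed.

Local Notation Sbar := (total_set S T).

(** Keys subject only to sum 0: one coordinate per user and one check. *)
Lemma achievable_full (rate : R * R) : (2 <= K)%N ->
  1 <= rate.1 -> (K - 1)%:R <= rate.2 -> achievable S T rate.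
Proof.
move=> K2 r1 r2; have k0 : 'I_K := Ordinal K2.
apply: (@kernel_achievable 'F_2 'I_K 1 1 (fun _ _ => 1) id) => //.
- move=> tau; exists (fun i => if i == k0 then tau 0%N else 0) => j.
  rewrite ltnS leqn0 => /eqP ->; rewrite (bigD1 k0) //= eqxx mulr1 big1 ?addr0 //.
  by move=> i /negbTE ->; rewrite mul0r.
- move=> m n u delta dU d0; exists (fun k => delta k 0 0); split.
  + move=> j _; under eq_bigr do rewrite mulr1.
    by rewrite -summxE d0 mxE.
  + by move=> k j kU; rewrite (big_pred1 k) //= dU // mxE mul0r.
  + by move=> k j kS; rewrite (big_pred1 k) //= mulr1 (ord1 j).
- by rewrite card_ord divr1.
Qed.

(** One coordinate per user of the total set and [#|Sbar| - astar S T] Vandermonde checks, check 0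
    being the sum. Covered coordinates take the values of [delta]; enough others are left to solve
    the checks. *)
Lemma achievable_mds (rate : R * R) : (astar S T < #|Sbar|)%N ->
  1 <= rate.1 -> (astar S T)%:R <= rate.2 -> achievable S T rate.
Proof.
move=> aS r1 r2.
have [F [alpha alpha_inj]] := exists_distinct_points {k : 'I_K | k \in Sbar}.
have cardS : #|{: {k : 'I_K | k \in Sbar}}| = #|Sbar| by rewrite card_sig.
apply: (@kernel_achievable F _ 1 (#|Sbar| - astar S T) (fun i j => alpha i ^+ j) val) => //.
- by rewrite subn_gt0.
- move=> tau; have [|y [_ yP]] := @vandermonde_solve _ _ alpha [set: _] (#|Sbar| - astar S T) tau alpha_inj.
    by rewrite cardsT cardS leq_subr.
  by exists y.
- move=> m n u delta dU d0.
  pose V : {set {k : 'I_K | k \in Sbar}} := [set i | val i \notin covered S T m n u].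
  pose d (i : {k : 'I_K | k \in Sbar}) := if val i \in covered S T m n u then delta (val i) 0 0 else 0.
  have rV : (#|Sbar| - astar S T <= #|V|)%N.
    rewrite leq_subLR addnC -cardS -(cardsC V) leq_add2l.
    apply: leq_trans (leq_astar S T m n u).
    rewrite -(card_imset _ val_inj); apply/subset_leq_card/fintype.subsetP => k /imsetP[i iV ->].
    by move: iV; rewrite 2!inE negbK => ci; rewrite /covered_total finset.in_setI ci (valP i).
  have [y [y0 yP]] := vandermonde_solve (fun j => - \sum_i d i * alpha i ^+ j) alpha_inj rV.
  have xE (i : {k : 'I_K | k \in Sbar}) : val i \in covered S T m n u -> d i + y i = delta (val i) 0 0.
    by move=> ci; rewrite y0 ?addr0 /d ?ci // inE negbK.
  exists (fun i => d i + y i); split.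
  + move=> j jr; under eq_bigr do rewrite mulrDl.
    by rewrite big_split /= yP // subrr.
  + move=> k j kU; rewrite big1 // => i /eqP ik; rewrite xE ik ?dU ?mxE ?mul0r //.
    by rewrite /covered -finset.setUA finset.in_setU kU orbT.
  + move=> k j kS; have kT : k \in Sbar.
      by rewrite finset.in_setU; apply/orP; left; apply/bigcupP; exists m.
    rewrite (big_pred1 (exist _ k kT)); last by move=> i; rewrite -val_eqE.
    by rewrite (ord1 j) expr0 mulr1 xE // /covered !finset.in_setU kS.
by rewrite cardS subKn ?divr1 // ltnW.
Qed.

(** Each user of the total set holds a free row of [L] coordinates, and each other user [k] holds
    [beta k] scalars at distinct Vandermonde points. The number of checks is [\sum_k beta k - B],
    which leaves [#|Sbar| * L + B] source symbols. *)
Lemma achievable_weights (L B : nat) (beta : 'I_K -> nat) (rate : R * R) :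
  (0 < L)%N -> astar S T = #|Sbar| ->
  (forall k, k \in Sbar -> beta k = 0%N) -> (L + B <= \sum_k beta k)%N ->
  (forall m n u, extremal S T m n u -> (\sum_(k in T n :|: [set u]) beta k <= B)%N) ->
  1 <= rate.1 -> (#|Sbar| * L + B)%N%:R / L%:R <= rate.2 -> achievable S T rate.
Proof.
move=> L0 aS beta0 LB betaU r1 r2.
have [F [alpha alpha_inj]] := exists_distinct_points {k : 'I_K & 'I_(beta k)}.
have cardS : #|{: {k : 'I_K | k \in Sbar}}| = #|Sbar| by rewrite card_sig.
(* Entry [j] of [v], padded by 0 for j >= L, since there may be more than [L] checks. *)
pose sel (v : 'rV[F]_L) (j : nat) := \sum_(l < L) v 0 l * (l == j :> nat)%:R.
have selE v (j : 'I_L) : sel v j = v 0 j.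
  rewrite /sel (bigD1 j) //= eqxx mulr1 big1 ?addr0 // => l /negbTE lj.
  by rewrite -[_ == _ :> nat]/(l == j) lj mulr0.
have selB (J : finType) (P : pred J) (v : J -> 'rV[F]_L) j :
    sel (\sum_(i | P i) v i) j = \sum_(i | P i) sel (v i) j.
  rewrite /sel exchange_big /=; apply: eq_bigr => l _.
  by rewrite summxE mulr_suml.
pose C (i : ({k : 'I_K | k \in Sbar} * 'I_L) + {k : 'I_K & 'I_(beta k)}) (j : nat) : F :=
  match i with inl p => (p.2 == j :> nat)%:R | inr t => alpha t ^+ j end.
pose owner (i : ({k : 'I_K | k \in Sbar} * 'I_L) + {k : 'I_K & 'I_(beta k)}) : 'I_K :=
  match i with inl p => val p.1 | inr t => tag t end.
pose r := (\sum_k beta k - B)%N.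
have Br : (B <= \sum_k beta k)%N by apply: leq_trans LB; rewrite leq_addl.
have cardT : #|{: {k : 'I_K & 'I_(beta k)}}| = (\sum_k beta k)%N.
  by rewrite card_tagged sumnE big_map big_enum; apply: eq_bigr => k _; rewrite card_ord.
pose vec (d : 'I_K -> 'rV[F]_L) (y : {k : 'I_K & 'I_(beta k)} -> F)
    (i : ({k : 'I_K | k \in Sbar} * 'I_L) + {k : 'I_K & 'I_(beta k)}) : F :=
  match i with inl p => d (val p.1) 0 p.2 | inr t => y t end.
have sumP (P : pred 'I_K) d y j : \sum_(i | P (owner i)) vec d y i * C i j =
    \sum_(k in Sbar | P k) sel (d k) j + \sum_(t | P (tag t)) y t * alpha t ^+ j.
  rewrite big_sumType /=; congr (_ + _).
  by rewrite big_sub_cond pair_big /=; apply: eq_bigl => p; rewrite andbT.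
apply: (@kernel_achievable F _ L r C owner) => //.
- by rewrite leq_subRL // addnC.
- move=> tau; have [|y [_ yP]] := @vandermonde_solve _ _ alpha [set: _] r tau alpha_inj.
    by rewrite cardsT cardT leq_subr.
  exists (vec (fun=> 0) y) => j jr; rewrite (sumP xpredT) yP // big1 ?add0r // => k _.
  by rewrite /sel big1 // => l _; rewrite mxE mul0r.
- move=> m n u delta dU d0; pose cov := covered S T m n u.
  pose e k := if k \in cov then delta k else 0.
  have [d [y [dE yE dy]]] : exists d y, [/\ forall k, k \in cov -> d k = delta k,
      forall t, tag t \in cov -> y t = 0 & forall j, (j < r)%N ->
        \sum_(k in Sbar) sel (d k) j + \sum_t y t * alpha t ^+ j = 0].
    (* In the extremal case at most [B] scalars are covered, so at least [r] others can solve the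
       checks. Otherwise some user of the total set is uncovered, and its row alone absorbs the
       sum. *)
    have [ext|next] := boolP (extremal S T m n u).
      pose V : {set {k : 'I_K & 'I_(beta k)}} := [set t | tag t \notin cov].
      have rV : (r <= #|V|)%N.
        rewrite leq_subLR addnC -cardT -(cardsC V) leq_add2l; apply: leq_trans (betaU _ _ _ ext).
        rewrite (_ : #|~: V| = \sum_(k in cov) beta k)%N.
          rewrite big_mkcond [leqRHS]big_mkcond; apply: leq_sum => k _.
          rewrite /cov /covered -finset.setUA finset.in_setU; case: (boolP (k \in S m)) => //= kS.
          by rewrite beta0 // finset.in_setU; apply/orP; left; apply/bigcupP; exists m.
        under eq_bigr do rewrite -[beta _]card_ord -sum1_card.
        rewrite sig_big_dep sum1_card; apply: eq_card => t.
        by rewrite 2!inE negbK; apply: esym; exact: andbT.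
      have [y [y0 yP]] := vandermonde_solve (fun j => - \sum_(k in Sbar) sel (e k) j) alpha_inj rV.
      exists e, y; split; first by rewrite /e => k ->.
        by move=> t tc; rewrite y0 // inE negbK.
      by move=> j jr; rewrite yP // subrr.
    have /fintype.subsetPn[k0 k0S k0c] : ~~ (Sbar \subset cov).
      apply: contra next => /finset.setIidPr cS.
      by rewrite /extremal /covered_total -/cov cS aS.
    exists (fun k => if k == k0 then - \sum_(k in Sbar) e k else e k), (fun=> 0); split => //.
      by move=> k kc; rewrite /e kc; case: eqP => // k'; rewrite -k' kc in k0c.
    move=> j jr; rewrite [X in _ + X]big1 ?addr0; last by move=> t _; rewrite mul0r.
    rewrite -selB (bigD1 k0) //= eqxx.
    rewrite [X in _ + X](eq_bigr e); last by move=> k /andP[_ /negbTE ->].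
    rewrite [X in - X](bigD1 k0) //= [e k0]/e (negbTE k0c) add0r addNr.
    by rewrite /sel big1 // => l _; rewrite mxE mul0r.
  have yk k (j : nat) : k \in cov -> \sum_(t | tag t == k) y t * alpha t ^+ j = 0.
    by move=> kc; rewrite big1 // => t /eqP tk; rewrite yE ?mul0r // tk.
  exists (vec d y); split=> [j jr|k j kU|k j kS].
  + rewrite (sumP xpredT); apply: etrans (dy j jr); congr (_ + _).
    by apply: eq_bigl => k; rewrite andbT.
  + have kc : k \in cov by rewrite /cov /covered -finset.setUA finset.in_setU kU orbT.
    rewrite (sumP (pred1 k)) yk // addr0 big1 // => k' /andP[_ /eqP ->].
    by rewrite selE dE // dU // mxE.
  + have kc : k \in cov by rewrite /cov /covered !finset.in_setU kS.
    have kT : k \in Sbar by rewrite finset.in_setU; apply/orP; left; apply/bigcupP; exists m.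
    rewrite (sumP (pred1 k)) yk // addr0 (big_pred1 k) ?selE ?dE // => k' /=.
    by case: eqP => [->|]; rewrite ?kT ?andbF.
rewrite card_sum card_prod cardS card_ord cardT /r.
by rewrite -addnBA ?leq_subr // subKn.
Qed.

End Kernel.

(** * The rate region *)

Section Direct.
Variables (R : realType) (K M N : nat) (S : 'I_M -> {set 'I_K}) (T : 'I_N -> {set 'I_K}).
Hypotheses (hK : (3 <= K)%N) (hN : (0 < N)%N).
Hypotheses (hS : monotone_system S) (hT : monotone_system T).
Hypothesis hS0 : (\bigcup_(m < M) S m)%SET != finset.set0.
Local Notation Sbar := (total_set S T).

Lemma sub_objective (b : 'I_K -> R) m n u : extremal S T m n u ->
  \sum_(k in (T n :|: [set u]) :\: Sbar) b k <= lp_objective S T b.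
Proof.
move=> ext; rewrite /lp_objective.
apply: le_trans (le_bigmax _ _ m); apply: le_trans (le_bigmax _ _ n).
exact: (@le_bigmax_cond _ _ _ _ u (fun u => extremal S T m n u)
  (fun u => \sum_(k in (T n :|: [set u]) :\: Sbar) b k)).
Qed.

(** A user [v] covered by no extremal set carries one scalar. Extremal colluders then hold no
    weight, so [L = 1] and [B = 0] suffice. *)
Lemma achievable_small_union (rate : R * R) : astar S T = #|Sbar| -> (#|Qset S T| < K)%N ->
  1 <= rate.1 -> (astar S T)%:R <= rate.2 -> achievable S T rate.
Proof.
move=> aS QK r1 r2; have [|v vQ] := @exists_notin _ (Qset S T); first by rewrite card_ord.
have vC m n u : extremal S T m n u -> v \notin covered S T m n u.
  move=> ext; apply: contra vQ => vC.
  by apply/bigcupP; exists m => //; apply/bigcupP; exists n => //; apply/bigcupP; exists u.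
apply: (@achievable_weights R K M N S T 1 0 (fun k => (k == v) : nat)) => //.
- have [m [n [u ext]]] := extremal_exists T hK hN hS0.
  move=> k kS; case: eqP => // kv; move: (vC _ _ _ ext).
  by rewrite -kv (fintype.subsetP (extremal_total ext aS)).
- by rewrite (bigD1 v) //= eqxx.
- move=> m n u ext; rewrite big1 // => k kU; case: eqP => // kv; case/negP: (vC _ _ _ ext).
  by rewrite -kv coveredE finset.in_setU kU orbT.
- by rewrite muln1 addn0 divr1 -aS.
Qed.

(** The weights [b k], scaled by a large [L] and rounded up, become the numbers of scalars. *)
Lemma achievable_lp (b : 'I_K -> R) (rate : R * R) : astar S T = #|Sbar| ->
  lp_feasible S T b -> 1 <= rate.1 -> (astar S T)%:R + lp_objective S T b < rate.2 ->
  achievable S T rate.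
Proof.
move=> aS [b1 b0] r1 r2; set obj := lp_objective S T b.
have obj0 : 0 <= obj by exact: bigmax_ge_id.
pose gap := rate.2 - (astar S T)%:R - obj.
have gap0 : 0 < gap by rewrite /gap; move: r2; rewrite -/obj; lra.
(* Rounding adds at most 1 to each of at most [K] weights; this [L] makes K / L at most [gap]. *)
pose L := (Num.truncn (K%:R / gap)).+1.
have L0 : 0 < L%:R :> R by rewrite ltr0n.
have Lgap : K%:R <= gap * L%:R.
  by rewrite mulrC -ler_pdivrMr // ltW // truncnS_gt.
pose beta k := if k \in Sbar then 0%N else (Num.truncn (L%:R * b k)).+1.
have betage k : k \notin Sbar -> L%:R * b k <= (beta k)%:R.
  by move=> kS; rewrite /beta (negbTE kS) ltW // truncnS_gt.
have betale k : k \notin Sbar -> (beta k)%:R <= L%:R * b k + 1.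
  by move=> kS; rewrite /beta (negbTE kS) -natr1 lerD2r truncn_le mulr_ge0 ?(b0 _ kS) ?ler0n.
have beta0 k : k \in Sbar -> beta k = 0%N by rewrite /beta => ->.
have betaV m n u : extremal S T m n u -> (L + \sum_(k in T n :|: [set u]) beta k <= \sum_k beta k)%N.
  move=> ext; have Scov := extremal_total ext aS.
  have LV : (L <= \sum_(k in ~: covered S T m n u) beta k)%N.
    rewrite -(ler_nat R) natr_sum -[leLHS]mulr1.
    apply: (@le_trans _ _ (L%:R * \sum_(k in ~: covered S T m n u) b k)).
      by rewrite ler_wpM2l ?b1 // ltW.
    rewrite mulr_sumr; apply: ler_sum => k; rewrite inE => kc; apply: betage.
    by apply: contra kc; exact: (fintype.subsetP Scov).
  rewrite [leqRHS](bigID (fun k => k \in covered S T m n u)) /= [leqRHS]addnC; apply: leq_add.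
    by apply: leq_trans LV _; rewrite (eq_bigl (fun k => k \notin covered S T m n u)) // => k; rewrite inE.
  rewrite big_mkcond [leqRHS]big_mkcond; apply: leq_sum => k _.
  by rewrite coveredE (finset.in_setU k (S m)); case: (k \in T n :|: _); rewrite ?orbT.
have [m0 [n0 [u0 ext0]]] := extremal_exists T hK hN hS0.
have Lsum : (L <= \sum_k beta k)%N.
  by apply: leq_trans (betaV _ _ _ ext0); rewrite leq_addr.
(* The second argument of [minn] secures [L + B <= \sum_k beta k]; by [betaV] the weight of extremal
   colluders still fits under it. *)
pose B := minn (Num.truncn (L%:R * obj + K%:R)) (\sum_k beta k - L).
have LK0 : 0 <= L%:R * obj + K%:R by rewrite addr_ge0 // mulr_ge0 // ltW.
apply: (@achievable_weights R K M N S T L B beta) => //.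
- by rewrite -leq_subRL // geq_minr.
- move=> m n u ext; rewrite leq_min; apply/andP; split; last first.
    by rewrite leq_subRL //; exact: betaV ext.
  rewrite truncn_ge_nat // natr_sum.
  apply: (@le_trans _ _ (\sum_(k in (T n :|: [set u]) :\: Sbar) (L%:R * b k + 1))).
    rewrite big_mkcond [leRHS]big_mkcond; apply: ler_sum => k _; rewrite finset.in_setD.
    case: (boolP (k \in Sbar)) => kS /=; first by rewrite beta0 //; case: ifP.
    by case: ifP => // _; exact: betale.
  rewrite big_split /= -mulr_sumr sumr_const lerD //.
    by apply: ler_wpM2l; [exact: ltW L0 | exact: sub_objective ext].
  by rewrite ler_nat -[leqRHS]card_ord max_card.
- rewrite ler_pdivrMr // natrD natrM -aS.
  have : B%:R <= L%:R * obj + K%:R.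
    apply: le_trans (_ : (Num.truncn (L%:R * obj + K%:R))%:R <= _); last by rewrite truncn_le.
    by rewrite ler_nat geq_minl.
  move: Lgap; rewrite /gap; nra.
Qed.

(** The strict inequality allows a feasible point near the infimum in place of a minimiser; the
    closure restores the boundary. *)
Lemma direct (rate : R * R) : 1 <= rate.1 -> Rstar R S T < rate.2 -> achievable S T rate.
Proof.
move=> r1; rewrite /Rstar; case: eqVneq => [_|aK] r2.
  by apply: achievable_full => //; [exact: ltn_trans hK|exact: ltW].
have Sa : (astar S T <= #|Sbar|)%N.
  have [m [n [u]]] := extremal_exists T hK hN hS0; rewrite /extremal => /eqP <-.
  by apply/subset_leq_card/finset.subsetIr.
have [aS|aS] := ltnP (astar S T) #|Sbar|.
  by apply: achievable_mds => //; move: r2; rewrite aS => /ltW.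
have {Sa aS}aS : astar S T = #|Sbar| by apply/eqP; rewrite eqn_leq Sa.
move: r2; rewrite -aS ltnn eqxx /=; case: ifP => [QK r2|_ r2].
  by apply: achievable_small_union => //; exact: ltW.
pose E := [set lp_objective S T b | b in @lp_feasible R K M N S T]%classic.
have infE : has_inf E.
  split; last by exists 0 => _ [c _ <-]; exact: bigmax_ge_id.
  (* The constant weight 1 is feasible, since an extremal covered set misses some user. *)
  exists (lp_objective S T (fun=> 1)); exists (fun=> 1) => //; split=> // m n u ext.
  have [v vN] := extremal_notin hK hN hT ext aK.
  by rewrite (bigD1 v) /= ?finset.in_setC ?vN // lerDl sumr_ge0.
have gap0 : 0 < rate.2 - (astar S T)%:R - bstar R S T by move: r2; lra.
have [_ [b feas <-] lt] := inf_adherent gap0 infE.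
apply: (achievable_lp aS feas r1); move: lt; rewrite -/(bstar R S T) /bstar; lra.
Qed.

End Direct.

Theorem theorem1 (R : realType) (K M N : nat)
    (S : 'I_M -> {set 'I_K}) (T : 'I_N -> {set 'I_K})
    (hK : (3 <= K)%N) (hN : (0 < N)%N)
    (hS : monotone_system S) (hT : monotone_system T)
    (hS0 : (\bigcup_(m < M) S m)%SET != finset.set0)
    (hT2 : forall n, (#|T n| <= K - 2)%N) :
  optimal_region R S T
    = [set r : R * R | 1 <= r.1 /\ Rstar R S T <= r.2]%classic.
Proof.
apply/seteqP; split=> r /=.
  move=> cl.
  (* Balls of the product are products of intervals, so both coordinates are approximated at
     once. *)
  have near e : 0 < e -> exists r' : R * R, [/\ 1 <= r'.1, Rstar R S T <= r'.2,
      `|r.1 - r'.1| < e & `|r.2 - r'.2| < e].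
    move=> e0; have [r' [/(converse hK hN hS hT hS0 hT2)[r1 r2] [b1 b2]]] := cl _ (nbhsx_ballx r e e0).
    by exists r'.
  split; rewrite leNgt; apply/negP => lt.
    have [|r' [r1 _ b1 _]] := near (1 - r.1); first by rewrite subr_gt0.
    by move: b1; rewrite ltr_norml => /andP[]; lra.
  have [|r' [_ r2 _ b2]] := near (Rstar R S T - r.2); first by rewrite subr_gt0.
  by move: b2; rewrite ltr_norml => /andP[]; lra.
move=> [r1 r2] B /nbhs_ballP[e /= e0 eB].
(* [direct] is strict in the second coordinate only; raising it by half the radius stays in the
   ball. *)
exists (r.1, r.2 + e / 2); split.
  by apply: direct => //=; move: r2; lra.
apply: eB; split=> /=; first exact: ballxx.
by rewrite /ball /= opprD addrA subrr sub0r normrN gtr0_norm; lra.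
Qed.
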